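(* Let $X,X_1,X_2,\ldots$ be i.i.d. non-negative random variables with mean $\nu$ and with moment-generating function $M_X(\vartheta)=\mathbb{E}[e^{\vartheta X}]$ finite for all $\vartheta$ in an open set containing $0$; let $\Lambda_X:=\log M_X$. Let $F$ be the distribution function of a non-negative random variable and $\overline F:=1-F$. For $i=1,\ldots,N$ let $$\omega_i(N):=N\int_{(i-1)/N}^{i/N}\overline F(1-x)\,dx,\qquad q_N(a):=\mathbb{P}\left(\mathrm{Pois}\left(\sum_{i=1}^NX_i\,\omega_i(N)\right)=Na\right).$$ Let $a>\nu\int_0^1\overline F(x)\,dx$, and let $$\vartheta^\star:=\arg\sup_\vartheta\left\{\vartheta a-\int_0^1\Lambda_X\left(\overline F(x)(e^\vartheta-1)\right)dx\right\},$$ assumed to exist, with $M_X$ finite in a neighbourhood of $\overline F(x)(e^{\vartheta^\star}-1)$ for every $x\in[0,1]$. Put $$\sigma^2:=a+\int_0^1\Lambda_X''\left(\overline F(x)(e^{\vartheta^\star}-1)\right)\overline F(x)^2\,e^{2\vartheta^\star}\,dx.$$ If $\overline F$ is twice differentiable on $[0,1]$, then, as $N\to\infty$ (through values for which $Na$ is an integer), $$q_N(a)\sim\check q_N(a):=e^{-\vartheta^\star Na}\exp\left(N\int_0^1\Lambda_X\left(\overline F(x)(e^{\vartheta^\star}-1)\right)dx\right)\frac{1}{\sqrt{2\pi N}\,\sigma}.$$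
   Context: For a non-negative random variable $Y$, $\mathrm{Pois}(Y)$ denotes a mixed Poisson random variable: conditionally on $Y=y$ it has the Poisson distribution with mean $y$. The notation $f(N)\sim g(N)$ means $f(N)/g(N)\to1$ as $N\to\infty$. Interpretation: $q_N(a)$ is the probability that an initially empty infinite-server queue has exactly $Na$ customers at time $1$, when service times are i.i.d. with distribution function $F$ and arrivals in $[(i-1)/N,i/N)$ occur as a Poisson process with rate $NX_i$; $\omega_i(N)$ is the probability that a customer arriving at a uniform epoch in that interval is still present at time $1$. *)

(* Defs.v *)
From HB Require Import structures.
From mathcomp Require Import all_boot all_order all_algebra.
From mathcomp Require Import all_classical all_reals all_analysis.

Set Implicit Arguments.
Unset Strict Implicit.
Unset Printing Implicit Defensive.

Import Order.TTheory GRing.Theory Num.Theory.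
Import numFieldNormedType.Exports.

Local Open Scope classical_set_scope.
Local Open Scope ring_scope.

Definition mutually_independent d (T : measurableType d) (R : realType)
    (P : probability T R) (X : nat -> {RV P >-> R}) : Prop :=
  forall (s : seq nat) (B : nat -> set R), uniq s ->
    (forall i, measurable (B i)) ->
    P (\bigcap_(i in [set` s]) (X i @^-1` B i)) =
    (\prod_(i <- s) P (X i @^-1` B i))%E.

Definition identically_distributed d (T : measurableType d) (R : realType)
    (P : probability T R) (X : nat -> {RV P >-> R}) : Prop :=
  forall (i j : nat) (B : set R), measurable B ->
    distribution P (X i) B = distribution P (X j) B.

Definition iid d (T : measurableType d) (R : realType)
    (P : probability T R) (X : nat -> {RV P >-> R}) : Prop :=
  mutually_independent X /\ identically_distributed X.

(* Law of Pois(Y): the mixture of the Poisson laws of mean [Y w], [w] being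
   distributed according to [P].  The second argument of [poisson_prob] is
   not used in its body, and [poisson_prob 0] is the Dirac mass at 0. *)
Definition mixed_poisson d (T : measurableType d) (R : realType)
    (P : probability T R) (Y : T -> R) (A : set nat) : \bar R :=
  (\int[P]_w poisson_prob (Y w) 0%N A)%E.

(* Extended-real valued: [log_mgf P X t = +oo] when the moment-generating
   function of [X] is infinite at [t]. *)
Definition log_mgf d (T : measurableType d) (R : realType)
    (P : probability T R) (X : T -> R) (t : R) : \bar R :=
  lne ('M_P X t).

Definition is_argsup (R : realType) (J : R -> \bar R) (t : R) : Prop :=
  J t = ereal_sup (range J).

(* The difference quotient only sees points of [D], so that the derivative is
   one-sided at the endpoints of an interval. *)
Definition has_derivative_within (R : realType) (D : set R) (f : R -> R)
    (x l : R) : Prop :=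
  (f y - f x) / (y - x) @[y --> within D x^'] --> l.

Definition twice_differentiable_on (R : realType) (D : set R) (f : R -> R)
    : Prop :=
  exists f1 f2 : R -> R, forall x, D x ->
    has_derivative_within D f x (f1 x) /\
    has_derivative_within D f1 x (f2 x).

Section queue.
Context (R : realType).
Local Notation mu := (@lebesgue_measure R).

Definition omega (Fbar : R -> R) (N i : nat) : R :=
  N%:R * \int[mu]_(x in `[(i%:R - 1) / N%:R, i%:R / N%:R]) Fbar (1 - x).

Context d (T : measurableType d) (P : probability T R).

(* Only [X 1], ..., [X N] enter the arrival rates. *)
Definition q_prob (X : nat -> {RV P >-> R}) (Fbar : R -> R) (a : R) (N : nat)
    : R :=
  fine (mixed_poisson P (fun w => \sum_(1 <= i < N.+1) X i w * omega Fbar N i)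
          [set k : nat | k%:R = N%:R * a]).

Definition rate_objective (X : {RV P >-> R}) (Fbar : R -> R) (a theta : R)
    : \bar R :=
  ((theta * a)%:E -
   \int[mu]_(x in `[0%R, 1%R]) log_mgf P X (Fbar x * (expR theta - 1)))%E.

Definition sigma2 (X : {RV P >-> R}) (Fbar : R -> R) (a theta : R) : R :=
  a + \int[mu]_(x in `[0, 1])
        (derive1n 2 (fine \o log_mgf P X) (Fbar x * (expR theta - 1))
         * Fbar x ^+ 2 * expR (2 * theta)).

Definition q_check (X : {RV P >-> R}) (Fbar : R -> R) (a theta : R) (N : nat)
    : R :=
  expR (- (theta * N%:R * a)) *
  expR (N%:R *
    \int[mu]_(x in `[0, 1]) fine (log_mgf P X (Fbar x * (expR theta - 1)))) *
  (Num.sqrt (2 * pi * N%:R) * Num.sqrt (sigma2 X Fbar a theta))^-1.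

End queue.

(* Main.v *)
(** Put z = e^theta, c = z - 1, k = N a and S = sum_i X_i omega_i. Then
    q_N(a) = E[e^-S S^k / k!] = z^-k E[e^(c S) p_k(z S)] with p_k(y) = e^-y y^k / k!,
    and the factor e^(c S), normalised by prod_i M_X(c omega_i), is a product
    tilting of the X_i, under which stationarity of theta makes z S have mean
    k + O(1). By Stirling, sqrt(2 pi k) p_k(y) is close to the Gaussian
    exp(-(y - k)^2 / (2 k)), which is a heat kernel; Lindeberg's replacement then
    applies one tilted summand at a time, each step advancing the heat time
    by the variance of the summand, so that no central limit theorem is needed: the
    tilted expectation converges to the kernel at time a + lim Var / N = sigma^2.
    The sums over i differ from N times the integrals by O(1), and by O(1/N) for
    log M_X, since the omega_i are cell averages of a Lipschitz function. *)

Require Import Defs.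
From HB Require Import structures.
From mathcomp Require Import all_boot all_order all_algebra.
From mathcomp Require Import all_classical all_reals all_analysis.
From mathcomp Require Import measurable_realfun ring lra.

Set Implicit Arguments.
Unset Strict Implicit.
Unset Printing Implicit Defensive.

Import Order.TTheory GRing.Theory Num.Theory.
Import numFieldNormedType.Exports.

Local Open Scope classical_set_scope.
Local Open Scope ring_scope.

(** * Taylor estimates *)

(** The Poisson mixture supplies the smoothing that a local statement requires. With [k = N a] and
    [z S = k + sqrt N * u], the Gaussian [exp(-(z S - k)^2 / (2 k))] is [exp(-u^2 / (2 a))], a heat
    kernel already at time [a > 0], where the derivatives involved are bounded. A replacement step
    then costs [O(N^(-3/2))], so all N of them together vanish. Passing from Poisson to Gaussian
    costs a multiple of [((z S - k) / k)^2], which the tilted second moment pays for; that moment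
    comes from the same replacement lemma, applied to [s + u^2]. The factor [sqrt a] left by the
    normalisation of the kernel combines with Stirling's [1 / sqrt (2 pi k)] into
    [1 / (sqrt (2 pi N) sigma)]. Since X is non-negative, one finite exponential moment at [b1 > b]
    bounds every tilted moment uniformly over tilts in [[lo, b]]; these three numbers therefore run
    through the whole proof. Stationarity is not given: theta only attains the supremum of an
    extended-valued function, and the first-order condition has to be extracted from that. *)

Section mean_value.
Context {R : realType}.
Implicit Types (f : R -> R) (x y t K : R).

(** Stated over the hull of [x] and [y] because increments of either sign occur below; [wlog]
    reduces to ordered endpoints. *)
Lemma mvt_abs f f' x y K :
  (forall t, Num.min x y <= t <= Num.max x y -> is_derive t 1 f (f' t)) ->
  (forall t, Num.min x y <= t <= Num.max x y -> `|f' t| <= K) ->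
  `|f y - f x| <= K * `|y - x|.
Proof.
wlog xy : x y / x <= y => [H df f'K|].
  have [|/ltW yx] := leP x y; first by move/H; exact.
  by rewrite distrC (distrC y); apply: H yx _ _ => t xyt; rewrite minC maxC in xyt;
    [exact: df | exact: f'K].
rewrite (min_idPl xy) (max_idPr xy) => df f'K.
have [||c /f'K cK ->] := @MVT_segment R f f' x y xy.
- by move=> t /[!in_itv]/= /andP[/ltW xt /ltW ty]; apply: df; rewrite xt ty.
- apply: derivable_within_continuous => t /[!in_itv]/= txy.
  by have [] := df t txy.
by rewrite normrM ler_wpM2r.
Qed.

(** Three uses of the mean value inequality, on [f2], on the remainder of [f1] and on that of [f].
    This loses the factor 1/6 of Taylor's formula, which is harmless here. *)
Lemma taylor2_abs f f1 f2 f3 x M :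
  (forall t, is_derive t 1 f (f1 t)) ->
  (forall t, is_derive t 1 f1 (f2 t)) ->
  (forall t, is_derive t 1 f2 (f3 t)) ->
  (forall t, `|f3 t| <= M) ->
  forall y, `|f (x + y) - f x - y * f1 x - y ^+ 2 / 2 * f2 x| <= M * `|y| ^+ 3.
Proof.
move=> d0 d1 d2 f3M y.
have M0 : 0 <= M by exact: le_trans (f3M 0).
have ty t : Num.min x (x + y) <= t <= Num.max x (x + y) -> `|t - x| <= `|y|.
  rewrite ge_min le_max ler_norml; have [y0|y0] := leP 0 y.
    by rewrite ger0_norm//; lra.
  by rewrite ltr0_norm//; lra.
have e2 t : `|f2 t - f2 x| <= M * `|t - x| by apply: (@mvt_abs _ f3).
have e1 t : Num.min x (x + y) <= t <= Num.max x (x + y) ->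
    `|f1 t - f1 x - (t - x) * f2 x| <= M * `|y| ^+ 2.
  move=> xty.
  pose g t := f1 t - t * f2 x.
  have -> : f1 t - f1 x - (t - x) * f2 x = g t - g x by rewrite /g; ring.
  apply: (le_trans (@mvt_abs g (fun t => f2 t - f2 x) _ _ (M * `|y|) _ _)).
  - move=> u _; rewrite /g.
    by apply: is_derive_eq; rewrite scaler0 add0r /GRing.scale/= mulr1.
  - move=> u ut; apply: le_trans (e2 u) _; rewrite ler_wpM2l//; apply: ty.
    move: xty ut; rewrite !ge_min !le_max; lra.
  by rewrite expr2 mulrA ler_wpM2l ?mulr_ge0// ty.
pose g t := f t - t * f1 x - (t - x) ^+ 2 / 2 * f2 x.
have -> : f (x + y) - f x - y * f1 x - y ^+ 2 / 2 * f2 x = g (x + y) - g x.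
  by rewrite /g; field.
rewrite exprS mulrCA mulrC.
apply: (le_trans (@mvt_abs g (fun t => f1 t - f1 x - (t - x) * f2 x) _ _
   (M * `|y| ^+ 2) _ e1)); last by rewrite addrAC subrr add0r.
move=> u _; rewrite /g.
apply: is_derive_eq.
by rewrite /GRing.scale/=; field.
Qed.

End mean_value.

(** * Poisson weights and the Gaussian *)

Section local_poisson.
Context {R : realType}.
Implicit Types x y eta : R.

(** The remainder has derivative [- t^2 / (1 + t)], and [1 + t >= 1/2] on the range considered. *)
Lemma ln1D_taylor x : `|x| <= 2^-1 -> `|x - ln (1 + x) - x ^+ 2 / 2| <= 2 * `|x| ^+ 3.
Proof.
move=> x2.
have tx t : Num.min 0 x <= t <= Num.max 0 x -> `|t| <= `|x|.
  rewrite ge_min le_max ler_norml; have [x0|x0] := leP 0 x.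
    by rewrite (ger0_norm x0); lra.
  by rewrite (ltr0_norm x0); lra.
have t2 t : Num.min 0 x <= t <= Num.max 0 x -> 2^-1 <= 1 + t.
  by move=> /tx tx'; have := le_trans tx' x2; rewrite ler_norml; lra.
pose g t := t - ln (1 + t) - t ^+ 2 / 2 : R.
have -> : x - ln (1 + x) - x ^+ 2 / 2 = g x - g 0.
  by rewrite /g addr0 ln1 expr0n/=; lra.
rewrite exprS mulrCA mulrC -[in leRHS](subr0 x).
apply: (@mvt_abs _ g (fun t => 1 - (1 + t)^-1 - t)) => t xt; have t12 := t2 t xt.
- have t0 : 0 < 1 + t by lra.
  have := is_derive1_ln t0 => dl.
  have dl1 : is_derive t 1 (fun t => ln (1 + t)) (1 + t)^-1.
    have d1 : is_derive t 1 (fun t : R => 1 + t) 1.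
      by apply: is_derive_eq; rewrite add0r mulr1.
    by have := is_derive1_comp dl d1; rewrite mulr1.
  rewrite /g; apply: is_derive_eq.
  by rewrite /GRing.scale/=; field; lra.
- have -> : 1 - (1 + t)^-1 - t = - (t ^+ 2 / (1 + t)) by field; lra.
  rewrite normrN ger0_norm; last by rewrite divr_ge0 ?sqr_ge0//; lra.
  have i2 : (1 + t)^-1 <= 2.
    by rewrite -[leRHS]invrK lef_pV2 ?posrE//; lra.
  rewrite -real_normK ?num_real// mulrC; apply: ler_pM => //.
    by rewrite invr_ge0; lra.
  by rewrite ler_pXn2r ?nnegrE// subr0 tx.
Qed.

Lemma expR_lip x y b : x <= b -> y <= b -> `|expR x - expR y| <= expR b * `|x - y|.
Proof.
move=> xb yb; apply: (@mvt_abs _ expR expR) => t; rewrite ge_min le_max => txy.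
by rewrite gtr0_norm ?expR_gt0// ler_expR; lra.
Qed.

(** Only an upper bound on [x] and [y] enters, so that the estimate survives integration with
    [x = t * X w] for tilts [t] of any sign. *)
Lemma expR_taylor1 x y b : x <= b -> y <= b ->
  `|expR y - expR x - (y - x) * expR x| <= expR b * (y - x) ^+ 2.
Proof.
move=> xb yb.
have -> : expR y - expR x - (y - x) * expR x =
    (expR y - y * expR x) - (expR x - x * expR x) by ring.
rewrite -real_normK ?num_real// expr2 mulrA.
apply: (@mvt_abs _ (fun t => expR t - t * expR x) (fun t => expR t - expR x)).
  move=> t _; apply: is_derive_eq.
  by rewrite scaler0 add0r /GRing.scale/= mulr1.
move=> t; rewrite ge_min le_max => xty.
apply: le_trans (@expR_lip _ _ b _ _) _ => //; first by lra.
rewrite ler_wpM2l ?expR_ge0//.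
by have [xy|xy] := leP x y; [rewrite (ger0_norm (_ : 0 <= t - x))  |
   rewrite (ler0_norm (_ : t - x <= 0))]; rewrite ?ler_norml ?ler_normr; lra.
Qed.

(* The Poisson weight [y ^ k e^-y / k!], normalised by its maximum over [y]. *)
Definition poisson_ratio (k : nat) y := (y / k%:R) ^+ k * expR (k%:R - y).

Lemma poisson_ratio_ge0 k y : 0 <= y -> 0 <= poisson_ratio k y.
Proof. by move=> y0; rewrite mulr_ge0 ?expR_ge0 ?exprn_ge0 ?divr_ge0. Qed.

(** The ratio is the [k]-th power of [(y / k) * exp (1 - y / k)], which is at most 1 by
    [1 + x <= exp x]. *)
Lemma poisson_ratio_le1 (k : nat) y : (0 < k)%N -> 0 <= y -> poisson_ratio k y <= 1.
Proof.
move=> k0 y0; have k0' : (0:R) < k%:R by rewrite ltr0n.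
rewrite /poisson_ratio (_ : k%:R - y = k%:R * (1 - y / k%:R)); last first.
  by field; rewrite gt_eqF.
rewrite expRM_natl -exprMn exprn_ile1 ?mulr_ge0 ?expR_ge0 ?divr_ge0//.
have := expR_ge1Dx (y / k%:R - 1); rewrite addrCA subrr addr0 => h.
have -> : 1 - y / k%:R = - (y / k%:R - 1) by rewrite opprB.
by rewrite expRN ler_pdivrMr ?expR_gt0// mul1r.
Qed.

(** The ratio is [exp (- k (x - ln (1 + x)))]. For [|x| <= eta] its exponent differs from
    [- k x^2 / 2] by at most [2 k |x|^3 <= 2 k eta x^2]; for [|x| > eta] both functions are at most
    1 and [2 <= 2 x^2 / eta^2]. A bound proportional to [x^2] in both regimes can be integrated with
    a second moment alone, and [eta] is chosen later. *)
Lemma poisson_ratio_gauss (k : nat) y eta : (0 < k)%N -> 0 <= y -> 0 < eta <= 2^-1 ->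
  let x := (y - k%:R) / k%:R in
  `|poisson_ratio k y - expR (- (y - k%:R) ^+ 2 / (2 * k%:R))|
    <= (2 * k%:R * eta + 2 / eta ^+ 2) * x ^+ 2.
Proof.
move=> k0 y0 eta0 /=; set x := _ / k%:R; have k0' : (0:R) < k%:R by rewrite ltr0n.
have e2 : 0 < eta ^+ 2 by rewrite exprn_gt0//; lra.
have c1 : 0 <= 2 * k%:R * eta by rewrite !mulr_ge0//; lra.
have [xe|xe] := leP `|x| eta; last first.
  apply: (@le_trans _ _ 2).
    apply: le_trans (ler_normB _ _) _.
    rewrite ger0_norm ?poisson_ratio_ge0// gtr0_norm ?expR_gt0// (_ : 2 = 1 + 1)//.
    rewrite lerD ?poisson_ratio_le1// -[leRHS]expR0 ler_expR.
    by rewrite mulNr oppr_le0 mulr_ge0 ?sqr_ge0 ?invr_ge0 ?mulr_ge0.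
  have : eta ^+ 2 <= x ^+ 2.
    by rewrite -[x ^+ 2]real_normK ?num_real// ler_pXn2r ?nnegrE//; lra.
  move=> h; apply: (@le_trans _ _ (2 / eta ^+ 2 * x ^+ 2)); last first.
    by rewrite ler_wpM2r ?sqr_ge0// lerDr.
  by rewrite -mulrA ler_peMr// mulrC ler_pdivlMr// mul1r.
have x12 : `|x| <= 2^-1 by lra.
have yE : y / k%:R = 1 + x by rewrite /x; field; rewrite gt_eqF.
have kyE : k%:R - y = - (k%:R * x) by rewrite /x; field; rewrite gt_eqF.
have -> : - (y - k%:R) ^+ 2 / (2 * k%:R) = - (k%:R * (x ^+ 2 / 2)).
  by rewrite /x; field; rewrite gt_eqF.
have x1 : 0 < 1 + x by move: x12; rewrite ler_norml; lra.
have -> : poisson_ratio k y = expR (- (k%:R * (x - ln (1 + x)))).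
  rewrite /poisson_ratio yE kyE -{1}(@lnK _ (1 + x)) ?posrE//.
  by rewrite -expRM_natl -expRD; congr expR; ring.
have l1 : ln (1 + x) <= x.
  by rewrite -[leRHS]expRK ler_ln ?posrE ?expR_gt0// expR_ge1Dx.
(* Both exponents are non-positive, so the exponential is 1-Lipschitz between them. *)
apply: le_trans (@expR_lip _ _ 0 _ _) _.
- by rewrite oppr_le0 mulr_ge0 ?subr_ge0// ltW.
- by rewrite oppr_le0 mulr_ge0 ?(ltW k0')// divr_ge0 ?sqr_ge0.
apply: (@le_trans _ _ (2 * k%:R * eta * x ^+ 2)); last first.
  by rewrite ler_wpM2r ?sqr_ge0// lerDl divr_ge0// ltW.
rewrite expR0 mul1r -opprD normrN (_ : k%:R * _ - _ = k%:R * (x - ln (1 + x) - x ^+ 2 / 2)).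
  2: by ring.
rewrite normrM (ger0_norm (ltW k0')).
apply: (@le_trans _ _ (k%:R * (2 * `|x| ^+ 3))).
  by rewrite ler_wpM2l ?(ltW k0')// ln1D_taylor.
rewrite (_ : k%:R * (2 * `|x| ^+ 3) = (2 * k%:R * `|x| ^+ 2) * `|x|); last by ring.
rewrite -[x ^+ 2]real_normK ?num_real// [leRHS]mulrAC ler_wpM2l// mulr_ge0 ?exprn_ge0// mulr_ge0.
Qed.

End local_poisson.

(** * Stirling's formula *)

Section stirling.
Context {R : realType}.
Local Notation mu := (@lebesgue_measure R).

Lemma integrable_itv_continuous (f : R -> R) (x y : R) : continuous f ->
  mu.-integrable `[x, y] (EFin \o f).
Proof.
move=> cf; apply: continuous_compact_integrable; first exact: segment_compact.
exact: continuous_subspaceT.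
Qed.

Lemma Rintegral_is_derive (f F : R -> R) (x y : R) : x < y -> continuous f ->
  (forall t : R, is_derive t 1 F (f t)) -> \int[mu]_(t in `[x, y]) f t = F y - F x.
Proof.
move=> xy cf dF.
have cF (t : R) : {for t, continuous F} by apply/differentiable_continuous/derivable1_diffP; have [] := dF t.
rewrite /Rintegral (@continuous_FTC2 R f F)//.
- exact: continuous_subspaceT.
- split=> [t _||]; first by have [] := dF t.
  + exact/cvg_at_right_filter/cF.
  + exact/cvg_at_left_filter/cF.
- by move=> t _; rewrite derive1E; have [] := dF t.
Qed.

Definition wallis n : R := \int[mu]_(t in `[0, pi / 2]) sin t ^+ n.

Lemma continuous_sinX n : continuous (fun t : R => sin t ^+ n).
Proof.
move=> t; apply: (@continuous_comp _ _ _ sin (fun u : R => u ^+ n)).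
  exact: continuous_sin.
exact: exprn_continuous.
Qed.

Let pi2 : 0 < pi / 2 :> R. Proof. by rewrite divr_gt0// pi_gt0. Qed.

Lemma wallis0 : wallis 0 = pi / 2.
Proof.
rewrite /wallis (@Rintegral_is_derive _ id)//; first by rewrite subr0.
- exact: continuous_sinX.
Qed.

Lemma wallis1 : wallis 1 = 1.
Proof.
have d (t : R) : is_derive t 1 (fun t : R => - cos t) (sin t ^+ 1).
  by rewrite expr1; apply: is_derive_eq; rewrite opprK.
rewrite /wallis (Rintegral_is_derive pi2 _ d); last exact: continuous_sinX.
by rewrite cos_pihalf cos0 oppr0 sub0r opprK.
Qed.

(** The difference of the two integrands is the derivative of [sin^(n+1) cos], which vanishes at 0
    and at [pi / 2]. *)
Lemma wallis_rec n : n.+2%:R * wallis n.+2 = n.+1%:R * wallis n.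
Proof.
pose f (t : R) := n.+1%:R * sin t ^+ n - n.+2%:R * sin t ^+ n.+2.
have cf m c : continuous (fun t : R => c * sin t ^+ m).
  by move=> t; apply: cvgM; [exact: cvg_cst | exact: continuous_sinX].
have i0 m : mu.-integrable `[0, pi / 2] (EFin \o (fun t : R => sin t ^+ m)).
  by apply: integrable_itv_continuous; exact: continuous_sinX.
have : \int[mu]_(t in `[0, pi / 2]) f t = 0.
  have d (t : R) : is_derive t 1 (fun t : R => sin t ^+ n.+1 * cos t) (f t).
    have ds : is_derive t 1 (fun t : R => sin t ^+ n.+1) (n.+1%:R * sin t ^+ n * cos t).
      by have := is_deriveX n.+1 (is_derive_sin t); rewrite exprfctE.
    apply: is_derive_eq; rewrite /GRing.scale/= /f.
    have -> : sin t ^+ n.+2 = sin t ^+ n * (1 - cos t ^+ 2).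
      by rewrite -sin2cos2 -exprD addn2.
    rewrite exprS -[n.+2]addn1 natrD; move: (sin t ^+ n) => S.
    transitivity (- sin t ^+ 2 * S + n.+1%:R * S * cos t ^+ 2); first by ring.
    by rewrite sin2cos2; ring.
  rewrite (Rintegral_is_derive pi2 _ d).
    by rewrite cos_pihalf sin0 expr0n/= mulr0 mul0r subr0.
  by move=> t; apply: cvgB; exact: cf.
rewrite /f RintegralB//=; [|exact: integrable_itv_continuous..].
rewrite !RintegralZl// => /subr0_eq; by [].
Qed.

Lemma wallis_ge0 n : 0 <= wallis n.
Proof.
apply: Rintegral_ge0 => t /=; rewrite in_itv/= => /andP[t0 tp].
by rewrite exprn_ge0// sin_ge0_pi// t0 (le_trans tp)// ler_pdivrMr// ler_peMr ?pi_ge0// ler1n.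
Qed.

Lemma wallis_nincr n : wallis n.+1 <= wallis n.
Proof.
apply: le_Rintegral => //; try by apply: integrable_itv_continuous; exact: continuous_sinX.
move=> t /=; rewrite in_itv/= => /andP[t0 tp].
rewrite exprS ler_piMl ?sin_le1// exprn_ge0// sin_ge0_pi// t0 (le_trans tp)//.
by rewrite ler_pdivrMr// ler_peMr ?pi_ge0// ler1n.
Qed.

Lemma wallis_prod n : n.+1%:R * wallis n.+1 * wallis n = pi / 2.
Proof.
elim: n => [|n IH]; first by rewrite wallis0 wallis1 !mul1r.
by rewrite wallis_rec mulrAC IH.
Qed.

(** With [wallis_ge], monotonicity turns the product identity into a two-sided bound, that is
    [wallis n ^+ 2 ~ pi / (2 n)]. *)
Lemma wallis_le n : n.+1%:R * wallis n.+1 ^+ 2 <= pi / 2.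
Proof.
by rewrite -(wallis_prod n) expr2 mulrA ler_wpM2l ?wallis_nincr// mulr_ge0 ?wallis_ge0.
Qed.

Lemma wallis_ge n : pi / 2 <= n.+1%:R * wallis n ^+ 2.
Proof.
by rewrite -(wallis_prod n) expr2 mulrA ler_wpM2r ?wallis_ge0// ler_wpM2l ?wallis_nincr.
Qed.

(** The closed form of the even Wallis integrals, freed of denominators; it ties them to the central
    binomial coefficient. *)
Lemma wallis_even n :
  wallis (n.*2) * (2 ^+ (n.*2) * n`!%:R ^+ 2) = pi / 2 * (n.*2)`!%:R.
Proof.
elim: n => [|n IH]; first by rewrite wallis0 expr0 fact0 expr1n !mulr1.
have n2 : (n.*2.+2)%:R != 0 :> R by rewrite pnatr_eq0.
apply: (mulfI n2); rewrite doubleS !factS !exprS !natrM exprMn.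
transitivity (n.*2.+2%:R * wallis n.*2.+2 * (2 ^+ n.*2 * n`!%:R ^+ 2) * (2 * n.+1%:R) ^+ 2).
  by ring.
rewrite wallis_rec -[2 * _]natrM mul2n doubleS.
transitivity (n.*2.+1%:R * (wallis n.*2 * (2 ^+ n.*2 * n`!%:R ^+ 2)) * n.*2.+2%:R ^+ 2).
  by ring.
by rewrite IH; ring.
Qed.

(** The logarithm of [n! e^n / n^(n + 1/2)]; Stirling's formula says that it tends to
    [ln (2 pi) / 2]. *)
Definition log_stirling n : R := ln n`!%:R + n%:R - (n%:R + 2^-1) * ln n%:R.

(** With [x = 1 / n] the difference is [(1/x + 1/2) ln (1 + x) - 1], where the terms of order 0 and
    1 in [x] cancel; [n >= 2] gives [x <= 1/2]. *)
Lemma log_stirlingS n : (2 <= n)%N ->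
  `|log_stirling n - log_stirling n.+1| <= 4 / n%:R ^+ 2.
Proof.
move=> n2; have n0 : (0:R) < n%:R by rewrite ltr0n (leq_trans _ n2).
set x := (n%:R : R)^-1; have nx : n%:R = x^-1 :> R by rewrite /x invrK.
have x0 : 0 < x by rewrite invr_gt0.
have x2 : x <= 2^-1 by rewrite lef_pV2 ?posrE// (ler_nat _ 2).
have -> : log_stirling n - log_stirling n.+1 = (x^-1 + 2^-1) * ln (1 + x) - 1.
  have -> : 1 + x = n.+1%:R / n%:R by rewrite -natr1 mulrDl divff ?gt_eqF// div1r.
  rewrite /log_stirling factS natrM lnM ?posrE ?ltr0n ?fact_gt0// ln_div ?posrE ?ltr0n ?(leq_trans _ n2)//.
  have -> : n.+1%:R = x^-1 + 1 :> R by rewrite -nx natr1.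
  by rewrite nx; ring.
have := @ln1D_taylor R x; rewrite gtr0_norm// => /(_ x2); set e := (x - _ - _) => he.
have -> : ln (1 + x) = x - x ^+ 2 / 2 - e by rewrite /e; ring.
have -> : (x^-1 + 2^-1) * (x - x ^+ 2 / 2 - e) - 1 = - (x ^+ 2 / 4 + (x^-1 + 2^-1) * e).
  by field; rewrite gt_eqF.
have c0 : 0 <= x^-1 + 2^-1 by rewrite addr_ge0 ?invr_ge0// ltW.
rewrite normrN (le_trans (ler_normD _ _))// [X in _ + X]normrM (ger0_norm c0).
rewrite (@ger0_norm _ (x ^+ 2 / 4)); last by rewrite divr_ge0 ?sqr_ge0.
apply: (@le_trans _ _ (x ^+ 2 / 4 + (x^-1 + 2^-1) * (2 * x ^+ 3))).
  by rewrite lerD2l ler_wpM2l.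
have -> : x ^+ 2 / 4 + (x^-1 + 2^-1) * (2 * x ^+ 3) = (9 / 4 + x) * x ^+ 2.
  by field; rewrite gt_eqF.
by rewrite nx exprVn invrK ler_wpM2r ?sqr_ge0//; lra.
Qed.

(** Crude telescoping; with [m = n] it gives [4 / n], hence [log_stirling n - log_stirling (2 n)]
    tends to 0. *)
Lemma log_stirlingD n m : (2 <= n)%N ->
  `|log_stirling n - log_stirling (n + m)| <= m%:R * (4 / n%:R ^+ 2).
Proof.
move=> n2; have n0 : (0:R) < n%:R by rewrite ltr0n (leq_trans _ n2).
elim: m => [|m IH]; first by rewrite addn0 subrr normr0 mul0r.
rewrite -natr1 mulrDl mul1r addnS.
rewrite -(subrKA (log_stirling (n + m))) (le_trans (ler_normD _ _))// lerD//.
apply: le_trans (log_stirlingS _) _; first by rewrite (leq_trans n2)// leq_addr.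
rewrite ler_wpM2l// lef_pV2 ?posrE ?exprn_gt0// ?ltr0n ?addn_gt0 ?(leq_trans _ n2)//.
by rewrite ler_pXn2r ?nnegrE// ler_nat leq_addr.
Qed.

Lemma cvg_norm_le {T : Type} {G : set_system T} {FF : Filter G} (u e : T -> R) (l : R) :
  (\forall n \near G, `|u n - l| <= e n) -> e @ G --> (0 : R) -> u @ G --> l.
Proof.
move=> ue e0; apply: (@squeeze_cvgr _ _ FF _ (fun n => l - e n) (fun n => l + e n)).
- by apply: filterS ue => n; rewrite ler_norml; lra.
- by rewrite -[X in _ --> X]subr0; apply: cvgB => //; exact: cvg_cst.
- by rewrite -[X in _ --> X]addr0; apply: cvgD => //; exact: cvg_cst.
Qed.

Lemma cvg_harmonicM (c : R) : c / n%:R @[n --> \oo] --> (0 : R).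
Proof.
rewrite -(mulr0 c); apply: cvgM; first exact: cvg_cst.
rewrite -(cvg_shiftS (fun n => n%:R^-1 : R)); exact: cvg_harmonic.
Qed.

Lemma ln_sqrtE (x : R) : 0 < x -> ln (Num.sqrt x) = ln x / 2.
Proof.
move=> x0; have s0 : 0 < Num.sqrt x by rewrite sqrtr_gt0.
by rewrite -{2}(sqr_sqrtr (ltW x0)) lnXn// -[ln _ *+ 2]mulr_natr mulfK// pnatr_eq0.
Qed.

Lemma cvg_stirling :
  k%:R ^+ k * expR (- k%:R) * Num.sqrt (2 * pi * k%:R) / k`!%:R @[k --> \oo] --> (1 : R).
Proof.
have pi0 : 0 < pi :> R by exact: pi_gt0.
(* If [l] is the limit of [log_stirling], then [2 l - l = l] is read off the
   central binomial coefficient, that is off Wallis' integrals. *)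
have Ldiff : log_stirling n - log_stirling n.*2 @[n --> \oo] --> (0:R).
  apply: cvg_norm_le (cvg_harmonicM 4); near=> n.
  have n2 : (2 <= n)%N by near: n; exact: nbhs_infty_ge.
  rewrite subr0 -addnn (le_trans (log_stirlingD _ n2))//.
  suff -> : n%:R * (4 / n%:R ^+ 2) = 4 / n%:R :> R by [].
  by field; rewrite pnatr_eq0 -lt0n (leq_trans _ n2).
have v : n%:R * wallis n.*2 ^+ 2 @[n --> \oo] --> (pi / 4 : R).
  apply: cvg_norm_le (cvg_harmonicM pi); near=> n.
  have n0 : (0 < n)%N by near: n; exact: nbhs_infty_gt.
  have n0' : (0:R) < n%:R by rewrite ltr0n.
  have := wallis_le n.*2.-1; rewrite prednK ?double_gt0//.
  have := wallis_ge n.*2; move: (wallis n.*2 ^+ 2) (sqr_ge0 (wallis n.*2)) => w w0.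
  rewrite -[n.*2.+1]addn1 natrD -muln2 natrM => h1 h2; rewrite ler_norml; apply/andP; split.
    suff : w <= pi / n%:R by lra.
    by rewrite ler_pdivlMr//; lra.
  have : 0 <= pi / n%:R :> R by rewrite divr_ge0// ltW.
  by lra.
have L : log_stirling n @[n --> \oo] --> (ln (2 * pi) / 2 : R).
  have -> : ln (2 * pi) / 2 = 2^-1 * (ln (pi ^+ 2 / 2) - ln (pi / 4)) - 0 :> R.
    rewrite subr0 mulrC; congr (_ * _); rewrite -ln_div ?posrE ?divr_gt0 ?exprn_gt0//.
    by congr ln; move: (pi : R) pi0 => p p0; field; rewrite gt_eqF.
  have w : 2^-1 * (ln (pi ^+ 2 / 2) - ln (n%:R * wallis n.*2 ^+ 2)) @[n --> \oo]
      --> (2^-1 * (ln (pi ^+ 2 / 2) - ln (pi / 4)) : R).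
    apply: cvgM; first exact: cvg_cst.
    apply: cvgB; first exact: cvg_cst.
    by apply: continuous_cvg v; apply: continuous_ln; rewrite divr_gt0.
  (* By [wallis_even] the sequence of [w] is exactly [2 log_stirling n - log_stirling (2 n)].
     Subtracting the vanishing sequence of [Ldiff] leaves [log_stirling n], so existence of the
     limit comes with its value. *)
  apply: cvg_trans (cvgB w Ldiff); apply: near_eq_cvg; near=> n.
  have n0 : (0 < n)%N by near: n; exact: nbhs_infty_gt.
  have n0' : (0:R) < n%:R by rewrite ltr0n.
  have w0 : 0 < wallis n.*2.
    rewrite lt_neqAle wallis_ge0 andbT; apply/eqP => w0; have := wallis_ge n.*2.
    by rewrite -w0 expr0n/= mulr0 leNgt divr_gt0.
  have f0 m : 0 < m`!%:R :> R by rewrite ltr0n fact_gt0.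
  have t0 : 0 < 2 ^+ n.*2 :> R by rewrite exprn_gt0.
  have h : ln (wallis n.*2) + (ln 2 * n%:R * 2 + ln n`!%:R * 2) =
      ln pi - ln 2 + ln (n.*2)`!%:R :> R.
    rewrite -ln_div ?posrE// -lnM ?posrE ?divr_gt0// -wallis_even.
    rewrite [RHS]lnM ?posrE ?(mulr_gt0 t0) ?exprn_gt0 ?f0//; congr (_ + _).
    rewrite lnM ?posrE ?exprn_gt0 ?f0// lnXn// lnXn ?f0//.
    by rewrite -[ln n`!%:R *+ 2]mulr_natr -[ln 2 *+ n.*2]mulr_natr -[n.*2]muln2 natrM mulrA.
  rewrite -[LHS]/(2^-1 * (ln (pi ^+ 2 / 2) - ln (n%:R * wallis n.*2 ^+ 2))
    - (log_stirling n - log_stirling n.*2)).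
  have -> : ln (n%:R * wallis n.*2 ^+ 2) = ln n%:R + ln (wallis n.*2) * 2 :> R.
    by rewrite lnM ?posrE ?exprn_gt0// lnXn// mulr_natr.
  have -> : ln (pi ^+ 2 / 2) = ln pi * 2 - ln 2 :> R.
    by rewrite ln_div ?posrE ?exprn_gt0// lnXn// mulr_natr.
  rewrite /= /log_stirling -[in ln (n.*2)%:R]muln2 -[in n.*2%:R]muln2 natrM lnM ?posrE//.
  move: h; move: (ln (n.*2)`!%:R) => y h.
  have -> : ln (wallis n.*2) = ln pi - ln 2 + y - (ln 2 * n%:R * 2 + ln n`!%:R * 2) :> R.
    by rewrite -h; ring.
  by field.
have E : expR (ln (2 * pi) / 2 - log_stirling n) @[n --> \oo] --> expR (0 : R).
  apply: (@continuous_cvg _ _ _ _ _ (fun n => ln (2 * pi) / 2 - log_stirling n) expR).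
    exact: continuous_expR.
  have -> : 0 = ln (2 * pi) / 2 - ln (2 * pi) / 2 :> R by rewrite subrr.
  by apply: cvgB; [exact: cvg_cst | exact: L].
rewrite expR0 in E; apply: cvg_trans E; apply: near_eq_cvg; near=> n.
have n0 : (0 < n)%N by near: n; exact: nbhs_infty_gt.
have n0' : (0:R) < n%:R by rewrite ltr0n.
have f0 : 0 < n`!%:R :> R by rewrite ltr0n fact_gt0.
have nn0 : 0 < n%:R ^+ n :> R by rewrite exprn_gt0.
have en0 : 0 < expR (- n%:R) :> R by rewrite expR_gt0.
have p0 : 0 < 2 * pi * n%:R :> R by rewrite !mulr_gt0.
have s0 : 0 < Num.sqrt (2 * pi * n%:R) :> R by rewrite sqrtr_gt0.
have m0 : 0 < n%:R ^+ n * expR (- n%:R) :> R by rewrite mulr_gt0.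
rewrite -[RHS]lnK; last by rewrite posrE divr_gt0// mulr_gt0.
congr expR; rewrite ln_div ?posrE//; last by rewrite mulr_gt0.
rewrite [ln (_ * Num.sqrt _)]lnM ?posrE// [ln (_ * expR _)]lnM ?posrE// lnXn// expRK ln_sqrtE//.
rewrite [ln (_ * n%:R)]lnM ?posrE ?mulr_gt0// /log_stirling -[ln _ *+ n]mulr_natr.
by field.
Unshelve. all: by end_near.
Qed.

End stirling.

(** * The heat kernel *)

Section heat_kernel.
Context {R : realType}.
Implicit Types s t u v y a : R.

(** The centred Gaussian density of variance [s] without its factor [(2 pi)^(-1/2)]; [s^(-1/2)] is
    put into the exponent so that each derivative is a rational factor times [heat]. *)
Definition heat s u := expR (- (ln s / 2) - u ^+ 2 / (2 * s)).
Definition heat_u s u := - (u / s) * heat s u.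
Definition heat_uu s u := (u ^+ 2 / s ^+ 2 - s^-1) * heat s u.

Lemma heat_ge0 s u : 0 <= heat s u. Proof. exact: expR_ge0. Qed.

Let is_derive_expr2 u : is_derive u 1 (fun t => t ^+ 2) (2 * u).
Proof. by apply: is_derive_eq; rewrite /GRing.scale/=; ring. Qed.

Lemma is_derive_heat_u s u : 0 < s -> is_derive u 1 (heat s) (heat_u s u).
Proof.
move=> s0; have d : is_derive u 1 (fun u => - (ln s / 2) - u ^+ 2 / (2 * s)) (- (u / s)).
  by apply: is_derive_eq; rewrite /GRing.scale/=; field; rewrite gt_eqF.
rewrite /heat_u [- _ * _]mulrC.
exact: (@is_derive1_comp _ expR _ u _ _ (is_derive_expR _) d).
Qed.

Lemma is_derive_heat_uu s u : 0 < s -> is_derive u 1 (heat_u s) (heat_uu s u).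
Proof.
move=> s0; have := is_derive_heat_u u s0 => d.
rewrite /heat_u; apply: is_derive_eq; rewrite /heat_uu /heat_u /GRing.scale/=.
by field; rewrite gt_eqF.
Qed.

Lemma is_derive_heat_uuu s u : 0 < s ->
  is_derive u 1 (heat_uu s) ((3 * u / s ^+ 2 - u ^+ 3 / s ^+ 3) * heat s u).
Proof.
move=> s0; have := is_derive_heat_u u s0 => d.
rewrite /heat_uu; apply: is_derive_eq; rewrite /heat_u /GRing.scale/=.
by field; rewrite gt_eqF.
Qed.

(** The heat equation, which lets the variance of a summand be traded for time. *)
Lemma is_derive_heat_s s u : 0 < s ->
  is_derive s 1 (heat^~ u) (2^-1 * heat_uu s u).
Proof.
move=> s0; have dl := is_derive1_ln s0.
have ns : s != 0 by rewrite gt_eqF.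
have n2s : 2 * s != 0 by rewrite gt_eqF// mulr_gt0.
have di : is_derive s 1 (fun s => (2 * s)^-1) (- (2 * s) ^- 2 * 2).
  have d2 : is_derive s 1 (fun s => 2 * s) 2.
    by apply: is_derive_eq; rewrite /GRing.scale/=; ring.
  exact: (@is_deriveV _ (fun s => 2 * s) s 2 1 n2s d2).
have d : is_derive s 1 (fun s => - (ln s / 2) - u ^+ 2 / (2 * s))
    (2^-1 * (u ^+ 2 / s ^+ 2 - s^-1)).
  by apply: is_derive_eq; rewrite /GRing.scale/=; field.
rewrite /heat_uu mulrA [_ * heat _ _]mulrC.
exact: (@is_derive1_comp _ expR _ s _ _ (is_derive_expR _) d).
Qed.

Lemma is_derive_heat_ss s u : 0 < s ->
  is_derive s 1 (fun s => 2^-1 * heat_uu s u)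
    ((4^-1 * (u ^+ 2 / s ^+ 2 - s^-1) ^+ 2 + (2^-1 / s ^+ 2 - u ^+ 2 / s ^+ 3))
      * heat s u).
Proof.
move=> s0; have ns : s != 0 by rewrite gt_eqF.
have d := is_derive_heat_s u s0.
have d1 : is_derive s 1 (fun s => s ^-1) (- s ^- 2).
  by have := @is_deriveV _ id s 1 1 ns (is_derive_id _ _); rewrite /GRing.scale/= mulr1.
have d2 : is_derive s 1 (fun s => (s ^+ 2)^-1) (- (s ^+ 2) ^- 2 * (2 * s)).
  exact: (@is_deriveV _ (fun s => s ^+ 2) s _ 1 (expf_neq0 2 ns) (is_derive_expr2 s)).
rewrite /heat_uu; apply: is_derive_eq; rewrite /heat_uu /GRing.scale/=.
by field.
Qed.

Let expRN_mul_le1 (p : R) : p * expR (- p) <= 1.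
Proof.
have := expR_ge1Dx p => h.
by rewrite expRN ler_pdivrMr ?expR_gt0// mul1r; lra.
Qed.

Let expRN_sqr_le (p : R) : 0 <= p -> p ^+ 2 * expR (- p) <= 4.
Proof.
move=> p0; have := expRN_mul_le1 (p / 2) => h.
have -> : p ^+ 2 * expR (- p) = 4 * (p / 2 * expR (- (p / 2))) ^+ 2.
  rewrite exprMn -expRM_natl.
  have -> : 2%:R * - (p / 2) = - p by field.
  by field.
rewrite ler_piMr// -[leRHS](expr1n _ 2) ler_pXn2r// ?nnegrE// mulr_ge0 ?expR_ge0//.
by rewrite divr_ge0.
Qed.

(* Every derivative of [heat] is [heat] times a polynomial in [s^-1] and
   [u ^+ 2 / s], and the Gaussian factor absorbs the latter. *)
Lemma heat_moments_le a s u c0 c1 c2 : 0 < a <= s ->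
  0 <= c0 -> 0 <= c1 -> 0 <= c2 ->
  let p := u ^+ 2 / (2 * s) in
  (c0 + c1 * p + c2 * p ^+ 2) * heat s u <=
    expR (- (ln a / 2)) * (c0 + c1 + 4 * c2).
Proof.
move=> /andP[a0 as_] c00 c10 c20 /=; set p := _ / _; have s0 := lt_le_trans a0 as_.
have p0 : 0 <= p by rewrite divr_ge0 ?sqr_ge0// mulr_ge0// ltW.
rewrite /heat expRD -/p mulrCA; apply: ler_pM; rewrite ?expR_ge0//.
- by rewrite mulr_ge0 ?expR_ge0// !addr_ge0// mulr_ge0// sqr_ge0.
- by rewrite ler_expR lerN2 ler_pM2r// ler_ln.
rewrite [leLHS]mulrDl [X in X + _ <= _]mulrDl -[c1 * _ * _]mulrA -[c2 * _ * _]mulrA; have e1 : expR (- p) <= 1.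
  by rewrite -[leRHS]expR0 ler_expR oppr_le0.
apply: lerD; last by rewrite [leRHS]mulrC ler_wpM2l// expRN_sqr_le.
by apply: lerD; rewrite ler_piMr// expRN_mul_le1.
Qed.

(** Second-order expansion in [u] and first-order expansion in time, where the heat equation turns
    [v] times the time derivative into [v / 2 * heat_uu]. For [y] centred with variance [v] the two
    correction terms have mean zero. The constant depends on [a] alone because the kernel is smooth
    uniformly for [s >= a]. *)
Lemma heat_step a : 0 < a -> exists2 C, 0 <= C & forall s u y v, a <= s -> 0 <= v ->
  `|heat s (u + y) - heat (s + v) u - y * heat_u s u - (y ^+ 2 - v) / 2 * heat_uu s u|
    <= C * (`|y| ^+ 3 + v ^+ 2).
Proof.
move=> a0; pose j := a^-1; pose E := expR (- (ln a / 2)).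
have j0 : 0 < j by rewrite invr_gt0.
(* [C1] bounds the third derivative in [u], [C2] the second in time: both are [c0 + c1 + 4 c2] of
   [heat_moments_le] with [s^-1] replaced by its bound [j]. *)
pose C1 := E * ((3 * j ^+ 2 + j ^+ 3) + 6 * j + 4 * (4 * j)).
pose C2 := E * (3 / 4 * j ^+ 2 + 3 * j ^+ 2 + 4 * j ^+ 2).
have E0 : 0 <= E by exact: expR_ge0.
have C10 : 0 <= C1 by rewrite mulr_ge0// !addr_ge0// ?mulr_ge0 ?exprn_ge0// ltW.
have C20 : 0 <= C2 by rewrite mulr_ge0// !addr_ge0// ?mulr_ge0 ?exprn_ge0// ltW.
exists (C1 + C2); first exact: addr_ge0.
move=> s u y v as_ v0.
have pos t : a <= t -> 0 < t by exact: lt_le_trans.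
have inv t : a <= t -> 0 <= t^-1 <= j.
  by move=> at_; rewrite invr_ge0 (ltW (pos _ at_)) lef_pV2 ?posrE// pos.
have B1 : `|heat s (u + y) - heat s u - y * heat_u s u - y ^+ 2 / 2 * heat_uu s u|
    <= C1 * `|y| ^+ 3.
  apply: (@taylor2_abs _ (heat s) (heat_u s) (heat_uu s)
    (fun u => (3 * u / s ^+ 2 - u ^+ 3 / s ^+ 3) * heat s u)) => t.
  - exact/is_derive_heat_u/pos.
  - exact/is_derive_heat_uu/pos.
  - exact/is_derive_heat_uuu/pos.
  have /andP[i0 ij] := inv _ as_; have s0 := pos _ as_.
  rewrite normrM (ger0_norm (heat_ge0 _ _)).
  apply: (@le_trans _ _ (((3 * s^-1 ^+ 2 + s^-1 ^+ 3) + 6 * s^-1 * (t ^+ 2 / (2 * s))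
     + 4 * s^-1 * (t ^+ 2 / (2 * s)) ^+ 2) * heat s t)).
    rewrite ler_wpM2r ?heat_ge0// (le_trans (ler_normB _ _))//.
    have sn n : 0 <= (s ^+ n)^-1 by rewrite invr_ge0 exprn_ge0// ltW.
    have -> : `|3 * t / s ^+ 2| = 3 * `|t| / s ^+ 2.
      by rewrite normrM (ger0_norm (sn _)) normrM ger0_norm.
    have -> : `|t ^+ 3 / s ^+ 3| = `|t| ^+ 3 / s ^+ 3.
      by rewrite normrM (ger0_norm (sn _)) normrX.
    (* Odd powers are dominated by even ones, since [heat_moments_le] only accepts polynomials in
       [t^2]. *)
    have t1 : `|t| <= 1 + t ^+ 2 by rewrite -real_normK ?num_real//; nra.
    have t3 : `|t| ^+ 3 <= 1 + t ^+ 4.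
      rewrite -[t ^+ 4]/(t ^+ (2 * 2)) exprM -[t ^+ 2]real_normK ?num_real// -exprM.
      have [z1|z1] := leP `|t| 1; last first.
        by rewrite -[leLHS]add0r lerD// ler_weXn2l// ltW.
      by apply: (@le_trans _ _ 1); [exact: exprn_ile1 | rewrite lerDl exprn_ge0].
    apply: (@le_trans _ _ (3 * (1 + t ^+ 2) / s ^+ 2 + (1 + t ^+ 4) / s ^+ 3)).
      by rewrite lerD// ler_wpM2r ?invr_ge0 ?exprn_ge0 ?(ltW s0)// ler_wpM2l.
    by rewrite le_eqVlt; apply/orP; left; apply/eqP; field; rewrite gt_eqF.
  apply: le_trans (@heat_moments_le a s t _ _ _ _ _ _ _) _.
  - by rewrite a0.
  - by rewrite addr_ge0 ?mulr_ge0 ?exprn_ge0.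
  - by rewrite mulr_ge0.
  - by rewrite mulr_ge0.
  rewrite ler_wpM2l// !lerD// ?ler_wpM2l// ler_pXn2r// nnegrE// ltW//.
have B2 : `|heat (s + v) u - heat s u - v / 2 * heat_uu s u| <= C2 * v ^+ 2.
  have vs t : Num.min s (s + v) <= t <= Num.max s (s + v) -> s <= t <= s + v.
    by rewrite (min_idPl _) ?(max_idPr _) ?lerDl.
  have B3 t : s <= t <= s + v ->
      `|2^-1 * heat_uu t u - 2^-1 * heat_uu s u| <= C2 * v.
    move=> st; apply: (@le_trans _ _ (C2 * `|t - s|)); last first.
      by rewrite ler_wpM2l// ger0_norm; lra.
    have rs r : Num.min s t <= r <= Num.max s t -> a <= r.
      by case/andP: st => st _; rewrite (min_idPl st) (max_idPr st) => /andP[/(le_trans as_)].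
    apply: (@mvt_abs _ (fun t => 2^-1 * heat_uu t u)
      (fun r => (4^-1 * (u ^+ 2 / r ^+ 2 - r^-1) ^+ 2 + (2^-1 / r ^+ 2 - u ^+ 2 / r ^+ 3))
        * heat r u)) => [r /rs ar|r /rs ar].
      exact/is_derive_heat_ss/pos.
    have /andP[i0 ij] := inv _ ar; have r0 := pos _ ar.
    rewrite normrM (ger0_norm (heat_ge0 _ _)).
    apply: (@le_trans _ _ ((3 / 4 * r^-1 ^+ 2 + 3 * r^-1 ^+ 2 * (u ^+ 2 / (2 * r))
       + r^-1 ^+ 2 * (u ^+ 2 / (2 * r)) ^+ 2) * heat r u)).
      rewrite ler_wpM2r ?heat_ge0//.
      have -> : 4^-1 * (u ^+ 2 / r ^+ 2 - r^-1) ^+ 2 + (2^-1 / r ^+ 2 - u ^+ 2 / r ^+ 3) =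
        3 / 4 * r^-1 ^+ 2 - 3 * r^-1 ^+ 2 * (u ^+ 2 / (2 * r)) + r^-1 ^+ 2 * (u ^+ 2 / (2 * r)) ^+ 2.
        by field; rewrite gt_eqF.
      have p0 : 0 <= 3 * r^-1 ^+ 2 * (u ^+ 2 / (2 * r)).
        by rewrite mulr_ge0 ?divr_ge0 ?sqr_ge0// ?mulr_ge0 ?exprn_ge0// ltW.
      have q0 : 0 <= r^-1 ^+ 2 * (u ^+ 2 / (2 * r)) ^+ 2.
        by rewrite mulr_ge0 ?sqr_ge0.
      have w0 := sqr_ge0 r^-1.
      by rewrite ler_norml; lra.
    apply: le_trans (@heat_moments_le a r u _ _ _ _ _ _ _) _.
    - by rewrite a0.
    - by rewrite mulr_ge0 ?sqr_ge0.
    - by rewrite mulr_ge0 ?sqr_ge0.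
    - exact: sqr_ge0.
    by rewrite ler_wpM2l// !lerD// ?ler_wpM2l// ler_pXn2r// nnegrE// ltW.
  pose g t := heat t u - t * (2^-1 * heat_uu s u).
  have -> : heat (s + v) u - heat s u - v / 2 * heat_uu s u = g (s + v) - g s.
    by rewrite /g; ring.
  have -> : C2 * v ^+ 2 = C2 * v * `|s + v - s|.
    by rewrite addrAC subrr add0r ger0_norm// -mulrA expr2.
  apply: (@mvt_abs _ g (fun t => 2^-1 * heat_uu t u - 2^-1 * heat_uu s u)).
    move=> t /vs /andP[st _]; have d := is_derive_heat_s u (pos _ (le_trans as_ st)).
    by rewrite /g; apply: is_derive_eq; rewrite /GRing.scale/=; ring.
  by move=> t /vs; exact: B3.
have -> : heat s (u + y) - heat (s + v) u - y * heat_u s u - (y ^+ 2 - v) / 2 * heat_uu s u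
  = (heat s (u + y) - heat s u - y * heat_u s u - y ^+ 2 / 2 * heat_uu s u)
    - (heat (s + v) u - heat s u - v / 2 * heat_uu s u) by ring.
apply: le_trans (ler_normB _ _) _; apply: le_trans (lerD B1 B2) _.
rewrite [leRHS]mulrDl lerD// ler_wpM2l// ?lerDl ?lerDr ?sqr_ge0 ?exprn_ge0//.
Qed.

End heat_kernel.

(** * Weighted sums of the arrival rates *)

Section weighted_sum.
Context d (T : measurableType d) (R : realType) (P : probability T R).
Variables (X : nat -> {RV P >-> R}) (c : nat -> R).

Definition wsum n w : R := \sum_(1 <= i < n.+1) X i w * c i.

Lemma wsumS n w : wsum n.+1 w = wsum n w + X n.+1 w * c n.+1.
Proof. by rewrite /wsum big_nat_recr. Qed.

Lemma measurable_wsum n : measurable_fun setT (wsum n).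
Proof. by apply: measurable_sum => i; apply: measurable_funM. Qed.

HB.instance Definition _ n := isMeasurableFun.Build _ _ _ _ (wsum n) (measurable_wsum n).

(** The past sum paired with the next rate: independence is expressed by identifying the law of this
    pair with a product measure. *)
Definition wsum_next n w : R * R := (wsum n w, X n.+1 w).

Lemma measurable_wsum_next n : measurable_fun setT (wsum_next n).
Proof. exact: measurable_fun_pair. Qed.

HB.instance Definition _ n :=
  isMeasurableFun.Build _ _ _ _ (wsum_next n) (measurable_wsum_next n).

Hypothesis X_iid : iid X.

Lemma iid_cylinder (s : seq nat) (B : nat -> set R) : (forall i, measurable (B i)) ->
  measurable (\bigcap_(i in [set` s]) (X i @^-1` B i)).
Proof.
move=> mB; rewrite bigcap_seq; apply: bigsetI_measurable => i _.
by rewrite -[X in measurable X]setTI; exact: measurable_funP.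
Qed.

(* The cylinder over later indices is what the induction on [n] consumes. *)
Lemma wsum_indep n (s : seq nat) (A : set R) (B : nat -> set R) :
  uniq s -> (forall i, i \in s -> (n < i)%N) -> measurable A ->
  (forall i, measurable (B i)) ->
  (P (wsum n @^-1` A `&` \bigcap_(i in [set` s]) (X i @^-1` B i)) =
   P (wsum n @^-1` A) * P (\bigcap_(i in [set` s]) (X i @^-1` B i)))%E.
Proof.
elim: n s A B => [|n IH] s A B us ns mA mB.
  have W0 w : wsum 0 w = 0 by rewrite /wsum big_geq.
  have [A0|A0] := pselect (A 0).
    have -> : wsum 0 @^-1` A = setT by apply/seteqP; split => // w _ /=; rewrite W0.
    by rewrite setTI probability_setT mul1e.
  have -> : wsum 0 @^-1` A = set0 by apply/seteqP; split => // w /=; rewrite W0.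
  by rewrite set0I measure0 mul0e.
pose C (s : seq nat) := \bigcap_(i in [set` s]) (X i @^-1` B i).
have mC t : measurable (C t) by exact: iid_cylinder.
pose D := (fun z : R * R => z.1 + z.2 * c n.+1) @^-1` A.
have mD : measurable D.
  rewrite -[D]setTI; apply: (_ : measurable_fun setT (fun z : R * R => z.1 + z.2 * c n.+1)) => //.
  by apply: measurable_funD => //; apply: measurable_funM.
have -> : wsum n.+1 @^-1` A = wsum_next n @^-1` D.
  by apply/seteqP; split => w /=; rewrite wsumS.
pose m1 := distribution P (wsum n).
pose m2 := distribution P (X n.+1).
have key t : uniq t -> (forall i, i \in t -> (n.+1 < i)%N) ->
    P (wsum_next n @^-1` D `&` C t) = (P (C t) * (m1 \x m2)%E D)%E.
  move=> ut nt; have PC0 : 0 <= fine (P (C t)) by rewrite fine_ge0.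
  have PC : (fine (P (C t)))%:E = P (C t) by rewrite fineK// fin_num_measure.
  (* The weight [P (C t)] is absorbed into the second factor, so that uniqueness of product measures
     applies to the law of the pair restricted to [C t]; agreement on rectangles is the induction
     hypothesis with [n.+1] added to the cylinder. *)
  pose m2C := mscale (NngNum PC0) m2.
  pose m' := pushforward (mrestr P (mC t)) (wsum_next n).
  have nt' : n.+1 \notin t by apply/negP => /nt; rewrite ltnn.
  transitivity ((m1 \x m2C)%E D); last first.
    rewrite /product_measure1 /m2C /mscale ge0_integralZl//; last first.
      exact: measurable_fun_xsection.
    by congr (_ * _)%E; exact: PC.
  symmetry; apply: (@product_measure_unique _ _ _ _ _ m1 m2C m') => //.
  move=> A' B' mA' mB'; pose B'' i := if i == n.+1 then B' else B i.
  have CE : \bigcap_(i in [set` n.+1 :: t]) (X i @^-1` B'' i) = X n.+1 @^-1` B' `&` C t.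
    rewrite bigcap_seq big_cons {1}/B'' eqxx /C bigcap_seq; congr (_ `&` _).
    rewrite big_seq [RHS]big_seq; apply: eq_bigr => i it; rewrite /B'' ifN//.
    by apply: contraNneq nt' => <-.
  have mB'' i : measurable (B'' i) by rewrite /B''; case: ifP.
  have utS : uniq (n.+1 :: t) by rewrite /= nt' ut.
  have := IH (n.+1 :: t) A' B'' utS _ mA' mB''; rewrite CE => IH'.
  have := X_iid.1 (n.+1 :: t) B'' utS mB''; rewrite CE big_cons {1}/B'' eqxx.
  have -> : (\prod_(i <- t) P (X i @^-1` B'' i) = P (C t))%E.
    rewrite /C X_iid.1// big_seq [RHS]big_seq; apply: eq_bigr => i it; rewrite /B'' ifN//.
    by apply: contraNneq nt' => <-.
  move=> XC.
  transitivity (P (wsum n @^-1` A') * P (X n.+1 @^-1` B' `&` C t))%E; last first.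
    rewrite XC; congr (_ * _)%E.
    transitivity ((fine (P (C t)))%:E * P (X n.+1 @^-1` B'))%E; last by [].
    by rewrite PC muleC.
  rewrite -IH'; first by rewrite /m' /pushforward /mrestr setIA.
  by move=> i; rewrite inE => /orP[/eqP ->//|/nt/ltnW].
(* The empty cylinder identifies the product measure of [D] with the probability of the event; the
   cylinder over [s] then gives the factorisation. *)
have := key [::] isT; rewrite (_ : C [::] = setT) ?setIT ?probability_setT ?mul1e.
  by move=> ->// ; rewrite -/(C s) key// muleC.
by rewrite /C bigcap_seq big_nil.
Qed.

(** The form in which the i.i.d. assumption enters the sequel: the last summand becomes a copy of
    [X 0] on a second copy of the space, and can be integrated out with the past frozen. *)
Lemma ge0_integral_wsumS n (f : R -> R) : measurable_fun setT f -> (forall x, 0 <= f x) ->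
  (\int[P]_w (f (wsum n.+1 w))%:E =
   \int[P]_w \int[P]_w' (f (wsum n w + X 0%N w' * c n.+1))%:E)%E.
Proof.
move=> mf f0.
pose m1 := distribution P (wsum n).
pose m2 := distribution P (X 0).
pose g (z : R * R) := (f (z.1 + z.2 * c n.+1))%:E.
have mg : measurable_fun setT g.
  apply/measurable_EFinP/measurableT_comp => //.
  by apply: measurable_funD => //; apply: measurable_funM.
have g0 z : (0 <= g z)%E by rewrite lee_fin.
have E D : measurable D -> (m1 \x m2)%E D = distribution P (wsum_next n) D.
  apply: (@product_measure_unique _ _ _ _ _ m1 m2 (distribution P (wsum_next n))) => //.
  move=> A B mA mB.
  have := @wsum_indep n [:: n.+1] A (fun=> B) isT _ mA (fun=> mB).
  rewrite bigcap_seq big_seq1 => h.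
  transitivity (P (wsum n @^-1` A) * P (X n.+1 @^-1` B))%E.
    by rewrite -h// => i; rewrite inE => /eqP ->.
  by congr (_ * _)%E; exact: (X_iid.2 n.+1 0%N B mB).
transitivity (\int[P]_w g (wsum_next n w))%E.
  by apply: eq_integral => w _; rewrite /g/= wsumS.
rewrite -[LHS](@ge0_integral_distribution _ _ _ _ _ P (wsum_next n) g)//.
rewrite -(eq_measure_integral _ (fun A mA _ => E A mA)) fubini_tonelli1//.
rewrite /fubini_F/= (@ge0_integral_distribution _ _ _ _ _ P (wsum n))//=.
- apply: eq_integral => w _ /=.
  rewrite (@ge0_integral_distribution _ _ _ _ _ P (X 0%N))//.
  exact: measurableT_comp mg _.
- exact: measurable_fun_fubini_tonelli_F.
- by move=> y; apply: integral_ge0.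
Qed.

End weighted_sum.

(** * Exponential moments and tilting *)

Section moments.
Context d (T : measurableType d) (R : realType) (P : probability T R).
Variables (X : {RV P >-> R}).
Hypothesis X_ge0 : forall w, 0 <= X w.

Definition xmom j t w : R := X w ^+ j * expR (t * X w).
Definition mom j t : R := \int[P]_w xmom j t w.

Lemma measurable_xmom j t : measurable_fun setT (xmom j t).
Proof.
apply: measurable_funM; first exact: measurable_funX.
by apply: measurableT_comp => //; apply: measurable_funM.
Qed.

Lemma xmom_ge0 j t w : 0 <= xmom j t w.
Proof. by rewrite mulr_ge0 ?expR_ge0 ?exprn_ge0. Qed.

Lemma mom_ge0 j t : 0 <= mom j t.
Proof. by apply: Rintegral_ge0 => w _; exact: xmom_ge0. Qed.

Variables (b b1 : R).
Hypotheses (b_gt0 : 0 < b) (bb1 : b < b1) (mgf_fin : ('M_P X b1 < +oo)%E).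

(** Since [X >= 0], the gap [b1 - b] absorbs the power: [y <= exp y] at [y = (b1 - b) x / j], raised
    to the power [j], gives [x^j <= (j / (b1 - b))^j exp ((b1 - b) x)]. *)
Lemma integrable_xmom j t : t <= b -> P.-integrable setT (EFin \o xmom j t).
Proof.
move=> tb; have d0 : 0 < b1 - b by rewrite subr_gt0.
pose K := (j%:R / (b1 - b)) ^+ j.
have i1 : P.-integrable setT (EFin \o (fun w => K * expR (b1 * X w))).
  rewrite (_ : EFin \o _ = (fun w => K%:E * (expR (b1 * X w))%:E)%E); last by [].
  apply: integrableZl => //; apply/integrableP; split.
    by apply/measurable_EFinP/measurableT_comp => //; apply: measurable_funM.
  rewrite (_ : (\int[P]_x `|(expR (b1 * X x))%:E| = 'M_P X b1)%E)//.
  rewrite /mmt_gen_fun unlock; apply: eq_integral => w _ /=.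
  by rewrite ger0_norm ?expR_ge0// mulrC.
apply: le_integrable i1 => //; first exact/measurable_EFinP/measurable_xmom.
move=> w _ /=; rewrite lee_fin !ger0_norm ?xmom_ge0//; last first.
  by rewrite mulr_ge0 ?expR_ge0// /K exprn_ge0// divr_ge0// ltW.
apply: (@le_trans _ _ (X w ^+ j * expR (b * X w))).
  by rewrite ler_wpM2l ?exprn_ge0// ler_expR ler_wpM2r.
have -> : b1 * X w = (b1 - b) * X w + b * X w by ring.
rewrite expRD mulrA ler_wpM2r ?expR_ge0//.
case: j @K => [|j] K; first by rewrite /K !expr0 mul1r -expR0 ler_expR mulr_ge0// ltW.
have jn : j.+1%:R != 0 :> R by rewrite pnatr_eq0.
rewrite /K; have -> : (b1 - b) * X w = j.+1%:R * ((b1 - b) * X w / j.+1%:R).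
  by rewrite [RHS]mulrC divfK.
rewrite expRM_natl -exprMn ler_pXn2r ?nnegrE ?mulr_ge0 ?expR_ge0 ?invr_ge0//; try exact: ltW.
pose y := (b1 - b) * X w / j.+1%:R; have := expR_ge1Dx y; rewrite -/y => h.
have -> : X w = j.+1%:R / (b1 - b) * y.
  by rewrite /y; move: jn; move: (j.+1%:R : R) => m mn; field; rewrite mn gt_eqF.
by rewrite ler_wpM2l ?divr_ge0 ?(ltW d0)//; lra.
Qed.

Lemma mom_le j t t' : t <= t' -> t' <= b -> mom j t <= mom j t'.
Proof.
move=> tt' t'b; apply: le_Rintegral => //; try apply: integrable_xmom => //.
  exact: le_trans t'b.
by move=> w _; rewrite ler_wpM2l ?exprn_ge0// ler_expR ler_wpM2r.
Qed.

(** Jensen's inequality by the tangent line of the exponential at [t * nu], [nu] being the mean: the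
    moment is at least [expR (t * nu)]. *)
Lemma mom_gt0 t : t <= b -> 0 < mom 0 t.
Proof.
move=> tb; pose nu := mom 1 0.
suff : expR (t * nu) <= mom 0 t by exact: lt_le_trans (expR_gt0 _).
pose g w := expR (t * nu) * (1 - t * nu) * xmom 0 0 w + expR (t * nu) * t * xmom 1 0 w.
have i0 j : P.-integrable setT (EFin \o xmom j 0) by apply: integrable_xmom; exact: ltW.
have iZ j k : P.-integrable setT (EFin \o (fun w => k * xmom j 0 w)).
  by rewrite (_ : EFin \o _ = (fun w => k%:E * (EFin \o xmom j 0) w)%E)//; exact: integrableZl.
have m00 : mom 0 0 = 1.
  rewrite /mom (_ : xmom 0 0 = cst 1); last by apply/funext => w; rewrite /xmom expr0 mul0r expR0 mulr1.
  have P1 : fine (P setT) = 1 by rewrite probability_setT.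
  by rewrite Rintegral_cst// mul1r; exact: P1.
have -> : expR (t * nu) = \int[P]_w g w.
  rewrite /g RintegralD// [X in _ = X + _]RintegralZl// [X in _ = _ + X]RintegralZl// -/(mom 0 0) -/(mom 1 0) m00 -/nu.
  ring.
apply: le_Rintegral => //; last first.
- move=> w _; rewrite /g /xmom expr0 expr1 mul0r expR0 !mulr1 mul1r.
  have -> : expR (t * X w) = expR (t * nu) * expR (t * X w - t * nu).
    by rewrite -expRD; congr expR; ring.
  rewrite -mulrA -mulrDr ler_wpM2l ?expR_ge0//.
  by have := expR_ge1Dx (t * X w - t * nu); lra.
- exact: integrable_xmom.
- exact: (integrableD measurableT (iZ 0%N _) (iZ 1%N _)).
Qed.

(** Quantitative differentiation under the expectation: the pointwise Taylor bound is uniform in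
    [t, t' <= b] and integrates to a moment at [b]. *)
Lemma mom_taylor j t t' : t <= b -> t' <= b ->
  `|mom j t' - mom j t - (t' - t) * mom j.+1 t| <= (t' - t) ^+ 2 * mom j.+2 b.
Proof.
move=> tb t'b.
have iZ i k s : s <= b -> P.-integrable setT (EFin \o (fun w => k * xmom i s w)).
  move=> sb; rewrite (_ : EFin \o _ = (fun w => k%:E * (EFin \o xmom i s) w)%E)//.
  by apply: integrableZl => //; exact: integrable_xmom.
have i1 : P.-integrable setT (EFin \o (fun w => xmom j t' w - xmom j t w)).
  exact: (integrableB measurableT (integrable_xmom j t'b) (integrable_xmom j tb)).
have i2 : P.-integrable setT (EFin \o (fun w => xmom j t' w - xmom j t w - (t' - t) * xmom j.+1 t w)).
  exact: (integrableB measurableT i1 (iZ _ _ _ tb)).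
rewrite -[X in _ * X]/(\int[P]_w xmom j.+1 t w) -RintegralZl//; last exact: integrable_xmom.
rewrite -[X in _ * X](_ : \int[P]_w xmom j.+2 b w = mom j.+2 b)// -RintegralZl//; last exact: integrable_xmom.
rewrite -RintegralB//; try exact: integrable_xmom.
rewrite -RintegralB//; last exact: iZ.
apply: le_trans (le_normr_Rintegral _ i2) _ => //.
apply: le_Rintegral => //; [exact: integrable_abse i2|exact: iZ|].
move=> w _; rewrite /xmom.
have -> : X w ^+ j * expR (t' * X w) - X w ^+ j * expR (t * X w)
      - (t' - t) * (X w ^+ j.+1 * expR (t * X w))
  = X w ^+ j * (expR (t' * X w) - expR (t * X w) - (t' * X w - t * X w) * expR (t * X w)).
  by rewrite exprS; ring.
rewrite normrM (ger0_norm (exprn_ge0 _ (X_ge0 _))).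
have := @expR_taylor1 R (t * X w) (t' * X w) (b * X w).
rewrite !ler_wpM2r// => /(_ isT isT) h.
apply: le_trans (ler_wpM2l (exprn_ge0 _ (X_ge0 _)) h) _.
by rewrite le_eqVlt; apply/orP; left; apply/eqP; rewrite !exprS; ring.
Qed.

End moments.

(** * Replacing one tilted summand *)

Section tilting.
Context d (T : measurableType d) (R : realType) (P : probability T R).
Variables (X : {RV P >-> R}).
Hypothesis X_ge0 : forall w, 0 <= X w.
Variables (b b1 lo : R).
Hypotheses (b_gt0 : 0 < b) (bb1 : b < b1) (mgf_fin : ('M_P X b1 < +oo)%E).
Hypothesis (lob : lo <= b).

(** Mean and variance of [X] under the law of density proportional to [expR (t * X)], that is the
    first two derivatives of the logarithm of the moment-generating function. *)
Definition tmean t : R := mom X 1 t / mom X 0 t.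
Definition tvar t : R := mom X 2 t / mom X 0 t - tmean t ^+ 2.

Let ix := integrable_xmom X_ge0 bb1 mgf_fin.
Let m0_gt0 := mom_gt0 X_ge0 b_gt0 bb1 mgf_fin.
Let m_ge0 := mom_ge0 X_ge0.

Let intZ j t k : t <= b -> P.-integrable setT (EFin \o (fun w => k * xmom X j t w)).
Proof.
move=> tb; rewrite (_ : EFin \o _ = (fun w => k%:E * (EFin \o xmom X j t) w)%E)//.
by apply: integrableZl => //; exact: ix.
Qed.

Let RintZ j t k : t <= b -> \int[P]_w (k * xmom X j t w) = k * mom X j t.
Proof. by move=> tb; rewrite RintegralZl//; exact: ix. Qed.

Let intZ2 i j t k l : t <= b ->
  P.-integrable setT (EFin \o (fun w => k * xmom X i t w + l * xmom X j t w)).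
Proof. by move=> tb; exact: (integrableD measurableT (intZ i k tb) (intZ j l tb)). Qed.

Let RintZ2 i j t k l : t <= b ->
  \int[P]_w (k * xmom X i t w + l * xmom X j t w) = k * mom X i t + l * mom X j t.
Proof. by move=> tb; rewrite RintegralD// ?RintZ//; exact: intZ. Qed.

Let intZ3 t k l m : t <= b -> P.-integrable setT
  (EFin \o (fun w => k * xmom X 0 t w + l * xmom X 1 t w + m * xmom X 2 t w)).
Proof. by move=> tb; exact: (integrableD measurableT (intZ2 0 1 k l tb) (intZ 2 m tb)). Qed.

Let RintZ3 t k l m : t <= b ->
  \int[P]_w (k * xmom X 0 t w + l * xmom X 1 t w + m * xmom X 2 t w) =
  k * mom X 0 t + l * mom X 1 t + m * mom X 2 t.
Proof. by move=> tb; rewrite RintegralD// ?RintZ ?RintZ2//; [exact: intZ2|exact: intZ]. Qed.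

Lemma tmean_ge0 t : 0 <= tmean t.
Proof. by rewrite divr_ge0. Qed.

Lemma tvar_ge0 t : t <= b -> 0 <= tvar t.
Proof.
move=> tb; have m0 := m0_gt0 tb; have m0n : mom X 0 t != 0 by rewrite gt_eqF.
suff -> : tvar t = (mom X 0 t)^-1 * \int[P]_w ((X w - tmean t) ^+ 2 * xmom X 0 t w).
  rewrite mulr_ge0 ?invr_ge0//; apply: Rintegral_ge0 => w _.
  by rewrite mulr_ge0 ?sqr_ge0// xmom_ge0.
transitivity ((mom X 0 t)^-1 * (tmean t ^+ 2 * mom X 0 t + (- 2 * tmean t) * mom X 1 t + 1 * mom X 2 t)).
  by rewrite /tvar /tmean; field.
rewrite -RintZ3//; congr (_ * _); apply: eq_Rintegral => w _.
by rewrite /xmom expr0 expr1; ring.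
Qed.

(** Bounds, uniform over tilts in [[lo, b]], for the tilted variance and the third absolute central
    moment. Numerators are taken at [b] and denominators at [lo] by monotonicity; the 4 comes from
    [(x + m)^3 <= 4 (x^3 + m^3)]. *)
Definition tbound2 : R := mom X 2 b / mom X 0 lo.
Definition tbound3 : R := 4 * (mom X 3 b / mom X 0 lo + (mom X 1 b / mom X 0 lo) ^+ 3).

Let mom_ratio j t : lo <= t <= b -> mom X j t / mom X 0 t <= mom X j b / mom X 0 lo.
Proof.
move=> /andP[lt tb]; apply: ler_pM => //; first by rewrite invr_ge0.
  exact: (mom_le X_ge0 bb1 mgf_fin).
by rewrite lef_pV2 ?posrE ?m0_gt0// (mom_le X_ge0 bb1 mgf_fin).
Qed.

Lemma tvar_le t : lo <= t <= b -> tvar t <= tbound2.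
Proof.
by move=> ltb; rewrite lerBlDr (le_trans (mom_ratio 2 ltb))// lerDl sqr_ge0.
Qed.

(** Under the tilted law [beta * (X - tmean t)] is centred with variance [v], so the second-order
    polynomial has mean exactly [H] whatever [D1] and [D2] are; the cubic remainder is dominated by
    third moments. *)
Lemma tilted_step (h : R -> R) (C H D1 D2 t beta : R) :
  lo <= t <= b -> 0 <= C -> measurable_fun setT h ->
  let v := beta ^+ 2 * tvar t in
  (forall y, `|h y - H - y * D1 - (y ^+ 2 - v) / 2 * D2| <= C * (`|y| ^+ 3 + v ^+ 2)) ->
  let g w := expR (t * X w) / mom X 0 t * h (beta * (X w - tmean t)) in
  P.-integrable setT (EFin \o g) /\
  `|\int[P]_w g w - H| <= C * (tbound3 * `|beta| ^+ 3 + tbound2 ^+ 2 * beta ^+ 4).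
Proof.
move=> ltb C0 mh v hstep g.
have /andP[lt tb] := ltb; have m0 := m0_gt0 tb.
have m0n : mom X 0 t != 0 by rewrite gt_eqF.
pose mu := tmean t; have mu0 : 0 <= mu := tmean_ge0 t.
pose i0 := (mom X 0 t)^-1; have i00 : 0 <= i0 by rewrite invr_ge0.
(* [p] is the weighted expansion sorted by powers of [X], and [q] below is its error bound sorted
   likewise, so that both integrate to moments. *)
pose p w := (i0 * (H - beta * mu * D1 + (beta ^+ 2 * mu ^+ 2 - v) / 2 * D2)) * xmom X 0 t w
  + (i0 * (beta * D1 - beta ^+ 2 * mu * D2)) * xmom X 1 t w
  + (i0 * (beta ^+ 2 / 2 * D2)) * xmom X 2 t w.
have ip : P.-integrable setT (EFin \o p) by exact: intZ3.
have Ip : \int[P]_w p w = H.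
  rewrite RintZ3// /v /tvar -/mu /i0.
  have -> : mom X 1 t = mu * mom X 0 t by rewrite /mu /tmean divfK.
  by field.
pose q w := C * i0 * (4 * `|beta| ^+ 3 * mu ^+ 3 + v ^+ 2) * xmom X 0 t w +
  C * i0 * (4 * `|beta| ^+ 3) * xmom X 3 t w.
have iq : P.-integrable setT (EFin \o q) by exact: intZ2.
have gpq w : `|g w - p w| <= q w.
  pose y := beta * (X w - mu).
  have -> : g w - p w = i0 * xmom X 0 t w * (h y - H - y * D1 - (y ^+ 2 - v) / 2 * D2).
    by rewrite /g /p /xmom -/mu -/y expr0 expr1 -/i0 /y; field.
  rewrite normrM (ger0_norm (mulr_ge0 i00 (xmom_ge0 X_ge0 _ _ _))).
  apply: le_trans (ler_wpM2l (mulr_ge0 i00 (xmom_ge0 X_ge0 _ _ _)) (hstep y)) _.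
  have y3 : `|y| ^+ 3 <= `|beta| ^+ 3 * (4 * (X w ^+ 3 + mu ^+ 3)).
    rewrite /y normrM exprMn ler_wpM2l ?exprn_ge0//.
    have xm : `|X w - mu| <= X w + mu.
      by rewrite (le_trans (ler_normB _ _))// !ger0_norm.
    apply: (@le_trans _ _ ((X w + mu) ^+ 3)).
      by rewrite ler_pXn2r ?nnegrE ?addr_ge0.
    have := X_ge0 w; move: (X w) => x x0; rewrite -subr_ge0.
    have -> : 4 * (x ^+ 3 + mu ^+ 3) - (x + mu) ^+ 3 = 3 * (x + mu) * (x - mu) ^+ 2 by ring.
    by rewrite mulr_ge0 ?sqr_ge0// mulr_ge0// addr_ge0.
  apply: (@le_trans _ _ (i0 * xmom X 0 t w * (C * (`|beta| ^+ 3 * (4 * (X w ^+ 3 + mu ^+ 3)) + v ^+ 2)))).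
    by rewrite ler_wpM2l ?mulr_ge0 ?xmom_ge0// ler_wpM2l// lerD2r.
  by rewrite le_eqVlt; apply/orP; left; apply/eqP; rewrite /q /xmom expr0; ring.
have mg : measurable_fun setT g.
  apply: measurable_funM.
    by apply: measurable_funM => //; apply: measurableT_comp => //; apply: measurable_funM.
  apply: (measurableT_comp mh); apply: measurable_funM => //.
  exact: measurable_funB.
have mp : measurable_fun setT p by case/integrableP : ip => /measurable_EFinP.
have igp : P.-integrable setT (EFin \o (fun w => g w - p w)).
  apply: le_integrable iq => //; first exact/measurable_EFinP/measurable_funB.
  by move=> w _ /=; rewrite lee_fin (le_trans (gpq w))// ler_norm.
have ig : P.-integrable setT (EFin \o g).
  rewrite (_ : EFin \o g = EFin \o (fun w => (g w - p w) + p w)); last first.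
    by apply/funext => w /=; rewrite subrK.
  exact: (integrableD measurableT igp ip).
split=> //.
rewrite -[X in _ - X]Ip -RintegralB//.
apply: le_trans (le_normr_Rintegral _ igp) _ => //.
apply: (@le_trans _ _ (\int[P]_w q w)).
  by apply: le_Rintegral => //; exact: integrable_abse igp.
rewrite RintZ2//.
have -> : C * i0 * (4 * `|beta| ^+ 3 * mu ^+ 3 + v ^+ 2) * mom X 0 t +
  C * i0 * (4 * `|beta| ^+ 3) * mom X 3 t =
  C * (4 * (mom X 3 t / mom X 0 t + mu ^+ 3) * `|beta| ^+ 3 + tvar t ^+ 2 * beta ^+ 4).
  by rewrite /v /i0; field.
have b4 : 0 <= beta ^+ 4 by rewrite -[beta ^+ 4]/(beta ^+ (2 * 2)) exprM sqr_ge0.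
rewrite ler_wpM2l//; apply: lerD; apply: ler_wpM2r => //.
  rewrite ler_wpM2l// lerD ?mom_ratio// ler_pXn2r ?nnegrE ?divr_ge0//.
  exact: (mom_ratio 1).
rewrite ler_pXn2r ?nnegrE ?tvar_ge0 ?tvar_le//.
by rewrite divr_ge0.
Qed.

End tilting.

(** * The Lindeberg replacement argument *)

Section ge0_integral_close.
Local Open Scope ereal_scope.
Context d (T : measurableType d) (R : realType) (mu : {measure set T -> \bar R}).

(** Finiteness of the integral of [f] is part of the conclusion; the replacement argument can thus
    remain with non-negative integrals and Tonelli's theorem. *)
Lemma ge0_integral_close (f g h : T -> \bar R) (r e : R) :
  measurable_fun setT f -> measurable_fun setT g -> measurable_fun setT h ->
  (forall w, 0 <= f w) -> (forall w, 0 <= g w) -> (forall w, 0 <= h w) ->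
  (forall w, f w <= g w + h w) -> (forall w, g w <= f w + h w) ->
  \int[mu]_w g w = r%:E -> \int[mu]_w h w = e%:E ->
  exists2 r', \int[mu]_w f w = r'%:E & (`|r' - r| <= e)%R.
Proof.
move=> mf mg mh f0 g0 h0 fgh gfh gr he.
have fr : \int[mu]_w f w <= (r + e)%:E.
  rewrite EFinD -gr -he -ge0_integralD//.
  by apply: ge0_le_integral => //; exact: emeasurable_funD.
have rf : r%:E <= \int[mu]_w f w + e%:E.
  rewrite -gr -he -ge0_integralD//.
  by apply: ge0_le_integral => //; exact: emeasurable_funD.
have f_ge0 : 0 <= \int[mu]_w f w by apply: integral_ge0 => w _.
move: fr rf f_ge0; case: (\int[mu]_w f w) => [r'| |]//.
rewrite -EFinD !lee_fin => fr rf f_ge0; exists r' => //.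
by rewrite ler_norml; lra.
Qed.

End ge0_integral_close.

Section lindeberg.
Context d (T : measurableType d) (R : realType) (P : probability T R).
Variables (X : nat -> {RV P >-> R}) (c : nat -> R).
Hypotheses (X_iid : iid X) (X_ge0 : forall i w, 0 <= X i w).
Variables (b b1 lo : R).
Hypotheses (b_gt0 : 0 < b) (bb1 : b < b1) (mgf_fin : ('M_P (X 0%N) b1 < +oo)%E).
Hypothesis (lob : lo <= b).
Variables (tau gamma u0 : R).
Hypothesis tau_c : forall i, lo <= tau * c i <= b.

Definition tilt_norm n : R := \prod_(1 <= i < n.+1) mom (X 0%N) 0 (tau * c i).
(** The scaled deviation from the tilted mean, started at [u0]. With [gamma = z / sqrt N] and [u0]
    the residual bias, its value for [n = N] is [(z x - k) / sqrt N]. *)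
Definition tilt_dev n x : R :=
  u0 + gamma * x - \sum_(1 <= i < n.+1) gamma * c i * tmean (X 0%N) (tau * c i).
Definition tilt_var n : R :=
  \sum_(1 <= i < n.+1) (gamma * c i) ^+ 2 * tvar (X 0%N) (tau * c i).

(* Expectation of [g] of the shifted and scaled sum under the law of [X 1], ...,
   [X n] with density proportional to [expR (tau * wsum X c n)]. *)
Definition tilted n (g : R -> R) : \bar R :=
  (\int[P]_w (expR (tau * wsum X c n w) / tilt_norm n
              * g (tilt_dev n (wsum X c n w)))%:E)%E.

Let m0_gt0 i : 0 < mom (X 0%N) 0 (tau * c i).
Proof. by apply: (mom_gt0 (X_ge0 0) b_gt0 bb1 mgf_fin); case/andP: (tau_c i). Qed.

Lemma tilt_norm_gt0 n : 0 < tilt_norm n.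
Proof. by rewrite /tilt_norm; elim/big_ind : _ => // x y; exact: mulr_gt0. Qed.

Lemma measurable_tilt_dev n : measurable_fun setT (tilt_dev n).
Proof.
by apply: measurable_funB => //; apply: measurable_funD.
Qed.

Let measurable_tilted n (g : R -> R) : measurable_fun setT g ->
  measurable_fun setT (fun x => expR (tau * x) / tilt_norm n * g (tilt_dev n x)).
Proof.
move=> mg; apply: measurable_funM.
  by apply: measurable_funM => //; apply: measurableT_comp => //; apply: measurable_funM.
by apply: measurableT_comp => //; exact: measurable_tilt_dev.
Qed.

Let weight_ge0 n x : 0 <= expR (tau * x) / tilt_norm n.
Proof. by rewrite divr_ge0 ?expR_ge0// ltW// tilt_norm_gt0. Qed.

Let step_integrand n (g : R -> R) w w' :
  let x := wsum X c n w + X 0%N w' * c n.+1 in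
  let t := tau * c n.+1 in
  expR (tau * x) / tilt_norm n.+1 * g (tilt_dev n.+1 x) =
  (expR (tau * wsum X c n w) / tilt_norm n) * (expR (t * X 0%N w') / mom (X 0%N) 0 t
    * g (tilt_dev n (wsum X c n w) + gamma * c n.+1 * (X 0%N w' - tmean (X 0%N) t))).
Proof.
move=> x t; rewrite /tilt_norm big_nat_recr//= -/(tilt_norm n) -/t.
have -> : tau * x = tau * wsum X c n w + t * X 0%N w' by rewrite /x /t; ring.
rewrite expRD; have -> : tilt_dev n.+1 x =
    tilt_dev n (wsum X c n w) + gamma * c n.+1 * (X 0%N w' - tmean (X 0%N) t).
  by rewrite /tilt_dev big_nat_recr//= -/t /x; ring.
rewrite invfM; ring.
Qed.

Lemma tilted_mass n : tilted n (fun=> 1) = 1%E.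
Proof.
elim: n => [|n IH].
  transitivity (\int[P]_w cst 1 w)%E; last by rewrite integral_cst// mul1e; exact: probability_setT.
  apply: eq_integral => w _; rewrite /wsum /tilt_norm !big_geq// mulr0 expR0.
  by rewrite invr1 !mulr1.
rewrite /tilted (ge0_integral_wsumS c X_iid n (f := fun x => expR (tau * x) / tilt_norm n.+1 * 1)); last 2 first.
- exact: (measurable_tilted n.+1 (measurable_cst _)).
- by move=> x; rewrite mulr1.
rewrite -IH; apply: eq_integral => w _.
have /andP[_ tb] := tau_c n.+1; set t := tau * c n.+1.
under eq_integral do rewrite (step_integrand n (fun=> 1)).
have im := integrable_xmom (X_ge0 0) bb1 mgf_fin 0 tb.
have -> : (fun w' => (expR (tau * wsum X c n w) / tilt_norm n *
   (expR (t * X 0%N w') / mom (X 0%N) 0 t * 1))%:E) =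
   (fun w' => (expR (tau * wsum X c n w) / tilt_norm n / mom (X 0%N) 0 t)%:E *
     (xmom (X 0%N) 0 t w')%:E)%E.
  by apply/funext => w'; rewrite -EFinM; congr EFin; rewrite /xmom; ring.
rewrite ge0_integralZl//; last 3 first.
- exact/measurable_EFinP/measurable_xmom.
- by move=> w' _; rewrite lee_fin xmom_ge0.
- by rewrite lee_fin divr_ge0 ?weight_ge0// ltW// m0_gt0.
have -> : (\int[P]_w' (xmom (X 0%N) 0 t w')%:E = (mom (X 0%N) 0 t)%:E)%E.
  by rewrite /mom /Rintegral fineK// (integrable_fin_num measurableT im).
by rewrite -EFinM mulr1 divfK// gt_eqF// m0_gt0.
Qed.

Lemma tilted_cst n k : 0 <= k -> tilted n (fun=> k) = k%:E.
Proof.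
move=> k0; rewrite -[RHS]mule1 -(tilted_mass n) /tilted -ge0_integralZl//.
- by apply: eq_integral => w _; rewrite -EFinM mulr1 mulrC.
- apply/measurable_EFinP.
  exact: (measurableT_comp (measurable_tilted n (measurable_cst (1 : R))) (measurable_wsum X c n)).
- by move=> w _; rewrite lee_fin mulr1.
Qed.

Lemma tilted_close n (f g h : R -> R) (r e : R) :
  measurable_fun setT f -> measurable_fun setT g -> measurable_fun setT h ->
  (forall u, 0 <= f u) -> (forall u, 0 <= g u) ->
  (forall u, `|f u - g u| <= h u) ->
  tilted n g = r%:E -> tilted n h = e%:E ->
  exists2 r', tilted n f = r'%:E & `|r' - r| <= e.
Proof.
move=> mf mg mh f0 g0 fgh; rewrite /tilted => gr he.
have mm k : measurable_fun setT k -> measurable_fun setT (fun w =>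
    (expR (tau * wsum X c n w) / tilt_norm n * k (tilt_dev n (wsum X c n w)))%:E).
  move=> mk; apply/measurable_EFinP.
  exact: (measurableT_comp (measurable_tilted n mk) (measurable_wsum X c n)).
apply: ge0_integral_close gr he; try exact: mm; move=> w.
- by rewrite lee_fin mulr_ge0.
- by rewrite lee_fin mulr_ge0.
- by rewrite lee_fin mulr_ge0// (le_trans _ (fgh _)).
- rewrite -EFinD lee_fin -mulrDr ler_wpM2l//.
  by have := fgh (tilt_dev n (wsum X c n w)); rewrite ler_norml; lra.
- rewrite -EFinD lee_fin -mulrDr ler_wpM2l//.
  by have := fgh (tilt_dev n (wsum X c n w)); rewrite ler_norml; lra.
Qed.

Variables (f fu fuu : R -> R -> R) (a C : R).
Hypotheses (C_ge0 : 0 <= C) (f_ge0 : forall s u, a <= s -> 0 <= f s u).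
Hypothesis measurable_f : forall s, measurable_fun setT (f s).
Hypothesis f_step : forall s u y v, a <= s -> 0 <= v ->
  `|f s (u + y) - f (s + v) u - y * fu s u - (y ^+ 2 - v) / 2 * fuu s u|
    <= C * (`|y| ^+ 3 + v ^+ 2).

Definition lindeberg_err n : R := \sum_(1 <= i < n.+1) C *
  (tbound3 (X 0%N) b lo * `|gamma * c i| ^+ 3 + tbound2 (X 0%N) b lo ^+ 2 * (gamma * c i) ^+ 4).

(** Integrating out the last summand moves the time from [s] to [s + v] at the cost of one error
    term; the induction hypothesis, at the later time, treats the rest. The family [f] is abstract
    because it is instantiated both by the heat kernel and by [s + u^2]. *)
Lemma lindeberg n s : a <= s ->
  exists2 r, tilted n (f s) = r%:E & `|r - f (s + tilt_var n) u0| <= lindeberg_err n.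
Proof.
elim: n s => [|n IH] s as_.
  exists (f s u0); last by rewrite /tilt_var /lindeberg_err !big_geq// addr0 subrr normr0.
  transitivity (\int[P]_w cst (f s u0)%:E w)%E; last first.
    by rewrite integral_cst// -[RHS]mule1; congr (_ * _)%E; exact: probability_setT.
  apply: eq_integral => w _; rewrite /wsum /tilt_norm /tilt_dev !big_geq// !mulr0 expR0.
  by rewrite addr0 subr0 invr1 !mul1r.
set t := tau * c n.+1; set beta := gamma * c n.+1.
pose v := beta ^+ 2 * tvar (X 0%N) t.
have ltb : lo <= t <= b by exact: tau_c.
have v0 : 0 <= v.
  by rewrite mulr_ge0 ?sqr_ge0// (tvar_ge0 (X_ge0 0) b_gt0 bb1 mgf_fin)//; case/andP: ltb.
have asv : a <= s + v by rewrite (le_trans as_)// lerDl.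
pose eps := C * (tbound3 (X 0%N) b lo * `|beta| ^+ 3 + tbound2 (X 0%N) b lo ^+ 2 * beta ^+ 4).
have [r' r'E r'le] := IH _ asv.
suff [r rE rle] : exists2 r, tilted n.+1 (f s) = r%:E & `|r - r'| <= eps.
  exists r => //; rewrite {1}/tilt_var big_nat_recr//= -/(tilt_var n) -/t -/beta -/v.
  rewrite (addrC (tilt_var n)) addrA /lindeberg_err big_nat_recr//= -/(lindeberg_err n).
  rewrite -(subrKA r') [leRHS]addrC (le_trans (ler_normD _ _))// lerD//.
pose G w := \int[P]_w' (expR (t * X 0%N w') / mom (X 0%N) 0 t *
  f s (tilt_dev n (wsum X c n w) + beta * (X 0%N w' - tmean (X 0%N) t))).
pose W w := expR (tau * wsum X c n w) / tilt_norm n.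
have step w := @tilted_step _ _ _ P (X 0%N) (X_ge0 0) b b1 lo b_gt0 bb1 mgf_fin lob
  (fun y => f s (tilt_dev n (wsum X c n w) + y)) C
  (f (s + v) (tilt_dev n (wsum X c n w))) (fu s (tilt_dev n (wsum X c n w)))
  (fuu s (tilt_dev n (wsum X c n w))) t beta ltb C_ge0
  (measurableT_comp (measurable_f s) (measurable_funD (measurable_cst _) (@measurable_id _ _ _)))
  (fun y => f_step _ y as_ v0).
have W0 w : 0 <= W w by exact: weight_ge0.
have mW : measurable_fun setT W.
  apply: measurable_funM => //; apply: measurableT_comp => //.
  by apply: measurable_funM => //; exact: measurable_wsum.
pose F x := expR (tau * x) / tilt_norm n.+1 * f s (tilt_dev n.+1 x).
have mF : measurable_fun setT F by exact: measurable_tilted.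
have F0 x : 0 <= F x by rewrite mulr_ge0// f_ge0.
have innerE w : (\int[P]_w' (F (wsum X c n w + X 0%N w' * c n.+1))%:E = (W w * G w)%:E)%E.
  have [ig _] := step w; rewrite /F.
  under eq_integral do rewrite step_integrand EFinM.
  rewrite (integralZl measurableT ig) [RHS]EFinM; congr (_ * _)%E.
  by rewrite /G /Rintegral fineK// (integrable_fin_num measurableT ig).
have G0 w : 0 <= G w.
  apply: Rintegral_ge0 => w' _; rewrite mulr_ge0 ?f_ge0//.
  by rewrite divr_ge0 ?expR_ge0// ltW// m0_gt0.
have -> : tilted n.+1 (f s) = (\int[P]_w (W w * G w)%:E)%E.
  rewrite /tilted (ge0_integral_wsumS c X_iid n mF F0).
  by apply: eq_integral => w _; exact: innerE.
(* [G] is defined by an integral, so its measurability is that of a section integral in Tonelli's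
   theorem. *)
have mWG : measurable_fun setT (fun w => (W w * G w)%:E).
  have -> : (fun w => (W w * G w)%:E) =
      (fun w => \int[P]_w' (F (wsum X c n w + X 0%N w' * c n.+1))%:E)%E.
    by apply/funext => w; rewrite innerE.
  apply: (measurable_fun_fubini_tonelli_F (m2 := P)
    (fun z : T * T => (F (wsum X c n z.1 + X 0%N z.2 * c n.+1))%:E)).
    apply/measurable_EFinP; apply: (measurableT_comp mF); apply: measurable_funD.
      exact: (measurableT_comp (measurable_wsum X c n) measurable_fst).
    by apply: measurable_funM => //; exact: measurableT_comp.
  by move=> z; rewrite lee_fin.
have eps0 : 0 <= eps.
  (* [eps] dominates an absolute value at any outcome, hence is non-negative. *)
  have := step point.
  by move=> [_]; exact: le_trans.
have GF w : `|G w - f (s + v) (tilt_dev n (wsum X c n w))| <= eps by have [] := step w.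
apply: (ge0_integral_close mWG _ _ _ _ _ _ _ r'E (tilted_cst n eps0)).
- apply/measurable_EFinP/measurable_funM => //.
  apply: (measurableT_comp (measurable_f _)).
  exact: (measurableT_comp (measurable_tilt_dev n) (measurable_wsum X c n)).
- by apply/measurable_EFinP/measurable_funM.
- by move=> w; rewrite lee_fin mulr_ge0.
- by move=> w; rewrite lee_fin mulr_ge0// f_ge0.
- by move=> w; rewrite lee_fin mulr_ge0.
- move=> w; rewrite -EFinD lee_fin -mulrDr ler_wpM2l//.
  by have := GF w; rewrite ler_norml; lra.
- move=> w; rewrite -EFinD lee_fin -mulrDr ler_wpM2l//.
  by have := GF w; rewrite ler_norml; lra.
Qed.

End lindeberg.

(** * Local limit under the tilted law *)

Section local_limit.
Context {R : realType}.

(* Clipping at 0 keeps [poisson_ratio] nonnegative for odd [k]; it changes nothing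
   on the range of the sum. *)
Lemma poisson_ratio_max_gauss (k : nat) (y eta : R) : (0 < k)%N -> 0 < eta <= 2^-1 ->
  `|poisson_ratio k (Num.max 0 y) - expR (- (y - k%:R) ^+ 2 / (2 * k%:R))|
    <= (2 * k%:R * eta + 2 / eta ^+ 2) * ((y - k%:R) / k%:R) ^+ 2.
Proof.
move=> k0 eta0; have k0' : (0:R) < k%:R by rewrite ltr0n.
have [y0|y0] := leP 0 y; first exact: poisson_ratio_gauss.
(* For [y < 0] the clipped ratio is 0 since [k > 0], the Gaussian is at most 1, and
   [|(y - k) / k| >= 1] makes the bound at least 1. *)
rewrite /poisson_ratio mul0r expr0n gtn_eqF// mul0r sub0r normrN gtr0_norm ?expR_gt0//.
apply: (@le_trans _ _ 1).
  by rewrite -[leRHS]expR0 ler_expR mulNr oppr_le0 divr_ge0 ?sqr_ge0// mulr_ge0.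
have e2 : 0 < eta ^+ 2 by rewrite exprn_gt0//; case/andP: eta0.
have e1 : 1 <= 2 / eta ^+ 2.
  rewrite ler_pdivlMr// mul1r; apply: (@le_trans _ _ 1); last by lra.
  by rewrite exprn_ile1//; lra.
have x1 : 1 <= ((y - k%:R) / k%:R) ^+ 2.
  rewrite -sqrrN -[leLHS](expr1n _ 2) -mulNr opprB ler_pXn2r ?nnegrE//.
    by rewrite ler_pdivlMr// mul1r; lra.
  by rewrite divr_ge0//; lra.
rewrite -[leLHS](mulr1 1) ler_pM// (le_trans e1)// lerDr mulr_ge0// ?mulr_ge0//; lra.
Qed.

End local_limit.

Section local_tilted.
Context d (T : measurableType d) (R : realType) (P : probability T R).
Variables (X : nat -> {RV P >-> R}) (c : nat -> R).
Hypotheses (X_iid : iid X) (X_ge0 : forall i w, 0 <= X i w).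
Variables (b b1 lo : R).
Hypotheses (b_gt0 : 0 < b) (bb1 : b < b1) (mgf_fin : ('M_P (X 0%N) b1 < +oo)%E).
Hypothesis (lob : lo <= b).
Variables (tau gamma u0 : R).
Hypothesis tau_c : forall i, lo <= tau * c i <= b.
Local Notation tilted := (tilted X c tau gamma u0).
Local Notation tilt_var := (tilt_var X c tau gamma).
Local Notation lindeberg_err := (lindeberg_err X c b lo gamma).

(** The function [s + u^2] satisfies the step relation with [C = 0], so replacement is exact and
    yields the second moment. *)
Lemma tilted_sqr n k : 0 <= k -> tilted n (fun u => k * u ^+ 2) = (k * (tilt_var n + u0 ^+ 2))%:E.
Proof.
move=> k0; pose f s u : R := k * (s + u ^+ 2).
have f0 s u : 0 <= s -> 0 <= f s u by move=> s0; rewrite mulr_ge0// addr_ge0// sqr_ge0.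
have mf s : measurable_fun setT (f s).
  by apply: measurable_funM => //; apply: measurable_funD => //; exact: exprn_measurable.
have fstep s u y v : 0 <= s -> 0 <= v ->
    `|f s (u + y) - f (s + v) u - y * (2 * k * u) - (y ^+ 2 - v) / 2 * (2 * k)|
    <= 0 * (`|y| ^+ 3 + v ^+ 2).
  by move=> s0 v0; rewrite mul0r (_ : _ - _ = 0) ?normr0//; rewrite /f; field.
have := @lindeberg _ _ _ P X c X_iid X_ge0 b b1 lo b_gt0 bb1 mgf_fin lob
  tau gamma u0 tau_c f _ _ 0 0 (lexx _) f0 mf fstep n 0 (lexx _); case.
move=> r; rewrite /lindeberg_err big1 => [|i _]; last by rewrite mul0r.
rewrite normr_le0 subr_eq0 => + /eqP rE.
rewrite (_ : f 0 = (fun u => k * u ^+ 2)); last by apply/funext => u; rewrite /f add0r.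
by rewrite rE /f add0r.
Qed.

(** At [y = k + sqrt N * u] with [k = N a] the Gaussian [exp (- (y - k)^2 / (2 k))] equals
    [sqrt a * heat a u], whence the starting time [a] and the factor [expR (ln a / 2)]. The first
    error is Poisson against Gaussian, integrated by [tilted_sqr]; the second is that of
    [lindeberg]. *)
Lemma local_tilted (a eta C : R) (N k : nat) : (0 < k)%N -> 0 < a -> k%:R = N%:R * a ->
  0 < eta <= 2^-1 -> 0 <= C ->
  (forall s u y v, a <= s -> 0 <= v ->
    `|heat s (u + y) - heat (s + v) u - y * heat_u s u - (y ^+ 2 - v) / 2 * heat_uu s u|
      <= C * (`|y| ^+ 3 + v ^+ 2)) ->
  exists2 r,
    tilted N (fun u => poisson_ratio k (Num.max 0 (k%:R + Num.sqrt N%:R * u))) = r%:E &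
    `|r - expR (ln a / 2) * heat (a + tilt_var N) u0| <=
      (2 * k%:R * eta + 2 / eta ^+ 2) / (a ^+ 2 * N%:R) * (tilt_var N + u0 ^+ 2)
      + lindeberg_err (expR (ln a / 2) * C) N.
Proof.
move=> k0 a0 kN eta0 C0 hC; set E := expR _; have E0 : 0 < E by exact: expR_gt0.
have k0' : (0:R) < k%:R by rewrite ltr0n.
have N0 : (0:R) < N%:R by move: k0'; rewrite kN pmulr_lgt0.
pose f s u : R := E * heat s u.
have mheat s : measurable_fun setT (@heat R s).
  apply: measurableT_comp => //; apply: measurable_funB => //.
  by apply: measurable_funM => //; exact: exprn_measurable.
have f0 s u : a <= s -> 0 <= f s u by move=> _; rewrite mulr_ge0 ?heat_ge0// ltW.
have mf s : measurable_fun setT (f s) by apply: measurable_funM.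
have fstep s u y v : a <= s -> 0 <= v ->
    `|f s (u + y) - f (s + v) u - y * (E * heat_u s u) - (y ^+ 2 - v) / 2 * (E * heat_uu s u)|
    <= E * C * (`|y| ^+ 3 + v ^+ 2).
  move=> as_ v0.
  have -> : f s (u + y) - f (s + v) u - y * (E * heat_u s u) - (y ^+ 2 - v) / 2 * (E * heat_uu s u)
     = E * (heat s (u + y) - heat (s + v) u - y * heat_u s u - (y ^+ 2 - v) / 2 * heat_uu s u).
    by rewrite /f; ring.
  by rewrite normrM (gtr0_norm E0) -[leRHS]mulrA ler_wpM2l ?hC// ltW.
have [r rE rle] := @lindeberg _ _ _ P X c X_iid X_ge0 b b1 lo b_gt0 bb1 mgf_fin lob
  tau gamma u0 tau_c f _ _ a (E * C) (mulr_ge0 (ltW E0) C0) f0 mf fstep N a (lexx _).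
pose K := (2 * k%:R * eta + 2 / eta ^+ 2) / (a ^+ 2 * N%:R).
have K0 : 0 <= K.
  by rewrite divr_ge0 ?addr_ge0 ?mulr_ge0 ?invr_ge0 ?exprn_ge0//; lra.
have Nn : N%:R != 0 :> R by rewrite gt_eqF.
have an : a != 0 by rewrite gt_eqF.
pose g u : R := poisson_ratio k (Num.max 0 (k%:R + Num.sqrt N%:R * u)).
have gf u : `|g u - f a u| <= K * u ^+ 2.
  have := @poisson_ratio_max_gauss R k (k%:R + Num.sqrt N%:R * u) eta k0 eta0.
  rewrite -/(g u) (addrC k%:R) addrK !exprMn sqr_sqrtr ?(ltW N0)// => h.
  have -> : f a u = expR (- (N%:R * u ^+ 2) / (2 * k%:R)).
    rewrite /f /E /heat -expRD kN; congr expR; field.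
    by rewrite Nn an.
  apply: le_trans h _; rewrite le_eqVlt; apply/orP; left; apply/eqP.
  rewrite /K kN; move: eta0 => /andP[/gt_eqF/negbT e0 _]; field.
  by rewrite Nn an e0.
have mg : measurable_fun setT g.
  rewrite /g /poisson_ratio.
  have mm : measurable_fun setT (fun u : R => Num.max 0 (k%:R + Num.sqrt N%:R * u)).
    by apply: measurable_maxr => //; apply: measurable_funD => //; apply: measurable_funM.
  apply: measurable_funM.
    by apply: measurable_funX; apply: measurable_funM.
  by apply: measurableT_comp => //; apply: measurable_funB.
have g0 u : 0 <= g u.
  by rewrite poisson_ratio_ge0// le_max lexx.
have mK : measurable_fun setT (fun u : R => K * u ^+ 2).
  by apply: measurable_funM => //; exact: exprn_measurable.
have [r' r'E r'le] := @tilted_close _ _ _ P X c X_ge0 b b1 lo b_gt0 bb1 mgf_fin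
  tau gamma u0 tau_c N g (f a) _ _ _ mg (mf a) mK g0 (fun u => f0 a u (lexx a)) gf rE (tilted_sqr N K0).
exists r' => //; rewrite -(subrKA r) (le_trans (ler_normD _ _))// lerD//.
Qed.

(** An exact identity, from [exp (- y) = exp (- k) * exp ((z - 1) y) * exp (k - z y)]: the middle
    factor is the tilt, the last one completes the Poisson ratio at [z y]. *)
Lemma mixed_poisson_tilted (N k : nat) (z : R) : (0 < k)%N -> (0 < N)%N -> 0 < z ->
  (forall i, 0 <= c i) -> tau = z - 1 -> gamma = z / Num.sqrt N%:R ->
  u0 = (z * \sum_(1 <= i < N.+1) c i * tmean (X 0%N) (tau * c i) - k%:R) / Num.sqrt N%:R ->
  (mixed_poisson P (wsum X c N) [set k] =
    (z ^- k * (k%:R ^+ k * expR (- k%:R) / k`!%:R) * tilt_norm X c tau N)%:E *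
     tilted N (fun u => poisson_ratio k (Num.max 0 (k%:R + Num.sqrt N%:R * u)))%R)%E.
Proof.
move=> k0 N0 z0 c0 tauE gammaE u0E; have k0' : (0:R) < k%:R by rewrite ltr0n.
have N0' : (0:R) < Num.sqrt N%:R by rewrite sqrtr_gt0 ltr0n.
have norm0 := tilt_norm_gt0 X_ge0 b_gt0 bb1 mgf_fin tau_c N.
have kf0 : 0 < k`!%:R :> R by rewrite ltr0n fact_gt0.
have poissonE y : 0 <= y ->
    poisson_prob y 0 [set k] = (y ^+ k / k`!%:R * expR (- y))%:E.
  (* At mean 0 the Poisson law is the Dirac mass at 0, and both sides vanish because [k > 0]. *)
  rewrite le_eqVlt => /predU1P[<-|y0].
    rewrite /poisson_prob ltxx diracE expr0n gtn_eqF// !mul0r.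
    by rewrite memNset// => k00; rewrite -k00 in k0.
  rewrite /poisson_prob y0 esum_set1 ?lee_fin ?poisson_pmf_ge0//.
  by rewrite /poisson_pmf y0.
have S0 w : 0 <= wsum X c N w.
  by apply: sumr_ge0 => i _; rewrite mulr_ge0.
set A := z ^- k * _ * _.
have A0 : 0 <= A.
  rewrite !mulr_ge0 ?expR_ge0 ?exprn_ge0 ?invr_ge0 ?(ltW norm0)//.
  by rewrite exprn_ge0// ltW.
rewrite /tilted -ge0_integralZl//; last 2 first.
- apply/measurable_EFinP.
  have mg : measurable_fun setT
      (fun u : R => poisson_ratio k (Num.max 0 (k%:R + Num.sqrt N%:R * u))).
    have mm : measurable_fun setT (fun u : R => Num.max 0 (k%:R + Num.sqrt N%:R * u)).
      by apply: measurable_maxr => //; apply: measurable_funD => //; apply: measurable_funM.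
    apply: measurable_funM.
      by apply: measurable_funX; apply: measurable_funM.
    by apply: measurableT_comp => //; apply: measurable_funB.
  apply: measurable_funM.
    apply: measurable_funM => //; apply: measurableT_comp => //.
    by apply: measurable_funM => //; exact: measurable_wsum.
  apply: (measurableT_comp mg).
  exact: (measurableT_comp (measurable_tilt_dev _ _ _ _ _ _) (measurable_wsum X c N)).
- move=> w _; rewrite lee_fin mulr_ge0 ?poisson_ratio_ge0 ?le_max ?lexx//.
  by rewrite divr_ge0 ?expR_ge0// ltW.
apply: eq_integral => w _; rewrite poissonE//; set y := wsum X c N w.
have -> : Num.max 0 (k%:R + Num.sqrt N%:R * tilt_dev X c tau gamma u0 N y) = z * y.
  have -> : k%:R + Num.sqrt N%:R * tilt_dev X c tau gamma u0 N y = z * y.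
    have -> : tilt_dev X c tau gamma u0 N y =
        u0 + gamma * y - gamma * \sum_(1 <= i < N.+1) c i * tmean (X 0%N) (tau * c i).
      by rewrite mulr_sumr; congr (_ - _); apply: eq_bigr => i _; rewrite mulrA.
    by rewrite u0E gammaE; field; rewrite gt_eqF.
  by apply/max_idPr; rewrite mulr_ge0 ?(ltW z0)//; exact: S0.
rewrite -EFinM; congr EFin; rewrite /poisson_ratio /A tauE.
have kk : k%:R ^+ k != 0 :> R by rewrite expf_neq0// gt_eqF.
have zk : z ^+ k != 0 by rewrite expf_neq0// gt_eqF.
have -> : expR (- y) = expR (- k%:R) * expR ((z - 1) * y) * expR (k%:R - z * y).
  by rewrite -!expRD; congr expR; ring.
rewrite !exprMn exprVn.
move: (expR _) (expR _) (expR _) => e1 e2 e3.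
move: kk zk; move: (k%:R ^+ k) (z ^+ k) (y ^+ k) => kk zk yk kk0 zk0.
by field; rewrite kk0 zk0 -tauE !gt_eqF.
Qed.

End local_tilted.

(** * Lipschitz profiles and Riemann sums *)

Section derivatives.
Context {R : realType}.
Implicit Types (f : R -> R) (x y l K : R).

Lemma is_derive_linear_approx f x l :
  (forall e, 0 < e -> \forall y \near x, `|f y - f x - (y - x) * l| <= e * `|y - x|) ->
  is_derive x 1 f l.
Proof.
move=> fl; suff h : h^-1 *: ((f \o shift x) (h *: 1) - f x) @[h --> 0^'] --> l.
  apply: DeriveDef; first by apply/cvg_ex; exists l.
  exact: cvg_lim.
apply/cvgrPdist_le => e e0; have := fl _ e0.
move/nbhs_ballP => [r /= r0 rP]; exists r => //= h /=.
rewrite sub0r normrN => hr h0; rewrite /GRing.scale/= mulr1.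
have -> : l - h^-1 * (f (h + x) - f x) = - (h^-1 * (f (h + x) - f x - (h + x - x) * l)).
  by rewrite addrK; field.
have := rP (h + x); rewrite /ball/= opprD addrCA subrr addr0 normrN => /(_ hr).
rewrite addrK normrN normrM normfV => hle.
by rewrite mulrC ler_pdivrMr ?normr_gt0.
Qed.

Lemma is_derive_quadratic_approx f x l K :
  (\forall y \near x, `|f y - f x - (y - x) * l| <= K * (y - x) ^+ 2) -> is_derive x 1 f l.
Proof.
move=> fK; apply: is_derive_linear_approx => e e0; pose M := `|K| + 1.
have M0 : 0 < M by rewrite ltr_pwDr.
near=> y; apply: (@le_trans _ _ (M * `|y - x| * `|y - x|)).
  rewrite -mulrA -expr2 real_normK ?num_real//.
  apply: (@le_trans _ _ (K * (y - x) ^+ 2)); first by near: y.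
  by rewrite ler_wpM2r ?sqr_ge0// (le_trans (ler_norm _))// lerDl.
rewrite ler_wpM2r// mulrC -ler_pdivlMr//; near: y.
by exists (e / M) => [|y /=]; [rewrite /= divr_gt0 | rewrite distrC => /ltW].
Unshelve. all: by end_near.
Qed.

Lemma has_derivative_within_le (D : set R) f x l (e : R) : 0 < e ->
  has_derivative_within D f x l ->
  \forall y \near x, D y -> `|f y - f x - (y - x) * l| <= e * `|y - x|.
Proof.
move=> e0 /cvgrPdist_le /(_ _ e0); rewrite near_withinE => h.
have {h} [r /= r0 rP] := h; exists r => //= y yr Dy.
have [->|yx] := eqVneq y x; first by rewrite !subrr mul0r subrr normr0 mulr0.
have y0 : y - x != 0 by rewrite subr_eq0.
have := rP y yr yx Dy => le.
have -> : f y - f x - (y - x) * l = (y - x) * - (l - (f y - f x) / (y - x)).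
  by field.
by rewrite normrM normrN mulrC ler_wpM2r.
Qed.

Definition unit_lipschitz K f := forall x y, 0 <= x <= 1 -> 0 <= y <= 1 ->
  `|f x - f y| <= K * `|x - y|.

Lemma has_derivative_within_continuous (D : set R) f (f' : R -> R) :
  (forall x, D x -> has_derivative_within D f x (f' x)) -> {within D, continuous f}.
Proof.
move=> df; apply/subspace_continuousP => x Dx.
have h := has_derivative_within_le ltr01 (df x Dx).
apply/cvgrPdist_le => e e0; rewrite near_withinE.
pose M := `|f' x| + 1; have M0 : 0 < M by rewrite ltr_pwDr.
near=> y => Dy; apply: (@le_trans _ _ (M * `|y - x|)).
  have : `|f y - f x - (y - x) * f' x| <= 1 * `|y - x| by move: Dy; near: y.
  rewrite mul1r => hy; rewrite [leLHS]distrC /M mulrDl mul1r.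
  rewrite -{1}(subrK ((y - x) * f' x) (f y - f x)) (le_trans (ler_normD _ _))// addrC lerD//.
  by rewrite normrM mulrC.
rewrite mulrC -ler_pdivlMr//; near: y.
by exists (e / M) => [|y /=]; [rewrite /= divr_gt0 | rewrite distrC => /ltW].
Unshelve. all: by end_near.
Qed.

(** The first derivative is itself differentiable, hence continuous, hence bounded on the compact
    interval. *)
Lemma unit_lipschitz_diff f : twice_differentiable_on `[0, 1] f ->
  exists2 L, 0 <= L & unit_lipschitz L f.
Proof.
move=> [f1 [f2 df]].
have cf1 : {within `[0, 1], continuous f1}.
  by apply: (has_derivative_within_continuous (f' := f2)) => x /df[].
have cf : {within `[0, 1], continuous f}.
  by apply: (has_derivative_within_continuous (f' := f1)) => x /df[].
have cn : {within `[0, 1], continuous (fun x => `|f1 x|)}.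
  by move=> x; apply: continuous_comp (cf1 x) _; exact: norm_continuous.
have [m _ mP] := EVT_max ler01 cn.
exists `|f1 m| => //.
suff lip x y : 0 <= x -> x <= y -> y <= 1 -> `|f y - f x| <= `|f1 m| * `|y - x|.
  move=> x y /andP[x0 x1] /andP[y0 y1]; have [xy|/ltW yx] := leP x y.
    by rewrite distrC (distrC x); exact: lip.
  exact: lip.
move=> x0 xy y1.
have sub : `[x, y] `<=` `[0, 1].
  by move=> t /=; rewrite !in_itv/= => /andP[xt ty]; rewrite (le_trans x0)// (le_trans ty).
have [||t /[!in_itv]/= /andP[xt ty] ->] := @MVT_segment R f f1 x y xy.
- move=> t /[!in_itv]/= /andP[xt ty].
  (* The point is interior to [[0, 1]], where the derivative within the interval is an ordinary
     one. *)
  have t01 : 0 < t < 1 by rewrite (le_lt_trans x0 xt) (lt_le_trans ty y1).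
  apply: is_derive_linear_approx => e e0.
  have Dt : `[0, 1]%classic t by rewrite /= in_itv/=; lra.
  have h := has_derivative_within_le e0 (df t Dt).1.
  near=> u.
  have : `[0, 1]%classic u -> `|f u - f t - (u - t) * f1 t| <= e * `|u - t| by near: u.
  apply; rewrite /= in_itv/=; near: u.
  have : \forall u \near t, u \in `]0, 1[ by apply: near_in_itvoo; rewrite in_itv.
  by apply: filterS => u; rewrite in_itv/=; lra.
- exact: continuous_subspaceW cf.
rewrite normrM ler_wpM2r// mP// in_itv/= (le_trans x0 xt) (le_trans ty)//.
Unshelve. all: by end_near.
Qed.

End derivatives.

(** * Integrals over the unit interval against sums over cells *)

Section riemann_sum.
Context {R : realType}.
Local Notation mu := (@lebesgue_measure R).
Implicit Types (f g : R -> R) (p q K : R).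

Lemma unit_lipschitz_continuous K f : unit_lipschitz K f -> {within `[0, 1], continuous f}.
Proof.
move=> fK; apply/subspace_continuousP => x /=; rewrite in_itv/= => x01.
pose M := `|K| + 1; have M0 : 0 < M by rewrite ltr_pwDr.
apply/cvgrPdist_le => e e0; rewrite near_withinE; near=> y => /=; rewrite in_itv/= => y01.
apply: le_trans (fK x y x01 y01) _; apply: (@le_trans _ _ (M * `|x - y|)).
  by rewrite ler_wpM2r// (le_trans (ler_norm _))// lerDl.
rewrite mulrC -ler_pdivlMr//; near: y.
by exists (e / M) => [|y /= /ltW]; rewrite /= ?divr_gt0.
Unshelve. all: by end_near.
Qed.

Lemma unit_lipschitz_integrable K f p q : unit_lipschitz K f -> 0 <= p -> q <= 1 ->
  mu.-integrable `[p, q] (EFin \o f).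
Proof.
move=> fK p0 q1; apply: continuous_compact_integrable; first exact: segment_compact.
apply: continuous_subspaceW (unit_lipschitz_continuous fK) => x /=.
by rewrite !in_itv/= => /andP[px xq]; rewrite (le_trans p0)// (le_trans xq).
Qed.

Lemma unit_lipschitz_onem K f : unit_lipschitz K f -> unit_lipschitz K (fun x => f (1 - x)).
Proof.
move=> fK x y x01 y01; rewrite (distrC x) (_ : y - x = (1 - x) - (1 - y)); last by ring.
by apply: fK; lra.
Qed.

Lemma unit_lipschitzB K K' f g : unit_lipschitz K f -> unit_lipschitz K' g ->
  unit_lipschitz (K + K') (fun x => f x - g x).
Proof.
move=> fK gK x y x01 y01; have -> : f x - g x - (f y - g y) = (f x - f y) - (g x - g y) by ring.
by rewrite (le_trans (ler_normB _ _))// mulrDl lerD ?fK ?gK.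
Qed.

Lemma unit_lipschitzZ K f k : unit_lipschitz K f ->
  unit_lipschitz (`|k| * K) (fun x => k * f x).
Proof. by move=> fK x y x01 y01; rewrite -mulrBr normrM -mulrA ler_wpM2l// fK. Qed.

Lemma Rintegral_onem K f : unit_lipschitz K f ->
  \int[mu]_(x in `[0, 1]) f (1 - x) = \int[mu]_(x in `[0, 1]) f x.
Proof.
move=> fK; rewrite [RHS]Rintegration_by_substitution_onem ?ler01 ?lexx//.
  by rewrite /unstable.onem subrr.
exact: unit_lipschitz_continuous fK.
Qed.

Lemma Rintegral_cst_itv p q k : p <= q -> \int[mu]_(x in `[p, q]) k = k * (q - p).
Proof.
move=> pq; have mupq : fine (mu `[p, q]%classic) = q - p.
  rewrite lebesgue_measure_itv/= lte_fin.
  by case: ltgtP pq => // -> _; rewrite subrr.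
by rewrite Rintegral_cst//; congr (_ * _); exact: mupq.
Qed.

Lemma Rintegral_itv_cat K f p q r : unit_lipschitz K f -> 0 <= p -> p <= q -> q <= r -> r <= 1 ->
  \int[mu]_(x in `[p, r]) f x = \int[mu]_(x in `[p, q]) f x + \int[mu]_(x in `[q, r]) f x.
Proof.
move=> fK p0 pq qr r1.
have := @Rintegral_itvB R f (BLeft p) (BRight r) q (unit_lipschitz_integrable fK p0 r1).
rewrite !bnd_simp => /(_ pq qr); rewrite (Rintegral_itv_obnd_cbnd _).
  by move=> <-; rewrite addrC subrK.
have i := unit_lipschitz_integrable fK (le_trans p0 pq) r1.
by apply: integrableS i => //; exact: subset_itv_oc_cc.
Qed.

Lemma Rintegral_unit_split K f N : unit_lipschitz K f -> (0 < N)%N ->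
  \int[mu]_(x in `[0, 1]) f x =
  \sum_(1 <= i < N.+1) \int[mu]_(x in `[(i%:R - 1) / N%:R, i%:R / N%:R]) f x.
Proof.
move=> fK N0; have N0' : (0:R) < N%:R by rewrite ltr0n.
suff H n : (n <= N)%N -> \int[mu]_(x in `[0, n%:R / N%:R]) f x =
    \sum_(1 <= i < n.+1) \int[mu]_(x in `[(i%:R - 1) / N%:R, i%:R / N%:R]) f x.
  by rewrite -H// divff ?gt_eqF.
elim: n => [_|n IH nN]; first by rewrite mul0r big_geq// set_itv1 Rintegral_set1.
rewrite big_nat_recr//= -IH; last exact: ltnW.
rewrite -natr1 addrK (@Rintegral_itv_cat K f 0 (n%:R / N%:R))//.
- by rewrite ler_pM2r ?invr_gt0// lerDl.
- by rewrite ler_pdivrMr// mul1r natr1 ler_nat.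
Qed.

Lemma Rintegral_sub_cst K f p q w : unit_lipschitz K f -> 0 <= p -> p <= q -> q <= 1 ->
  \int[mu]_(x in `[p, q]) (f x - w) = \int[mu]_(x in `[p, q]) f x - w * (q - p).
Proof.
move=> fK p0 pq q1; rewrite RintegralB//.
- by rewrite Rintegral_cst_itv.
- exact: unit_lipschitz_integrable fK _ _.
- by apply: integrable_itv_continuous; exact: cst_continuous.
Qed.

Lemma normr_Rintegral_itv_le K f p q e : unit_lipschitz K f -> 0 <= p -> p <= q -> q <= 1 ->
  (forall x, p <= x <= q -> `|f x| <= e) -> `|\int[mu]_(x in `[p, q]) f x| <= e * (q - p).
Proof.
move=> fK p0 pq q1 fe; have i := unit_lipschitz_integrable fK p0 q1.
apply: le_trans (le_normr_Rintegral _ i) _ => //.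
rewrite -Rintegral_cst_itv//; apply: le_Rintegral => //.
- exact: integrable_abse i.
- by apply: integrable_itv_continuous; exact: cst_continuous.
Qed.

Lemma Rintegral_approx Kf Kg Km f g m D e :
  unit_lipschitz Kf f -> unit_lipschitz Kg g -> unit_lipschitz Km m ->
  (forall x, 0 <= x <= 1 -> `|f x - g x - D * m x| <= e) ->
  `|\int[mu]_(x in `[0, 1]) f x - \int[mu]_(x in `[0, 1]) g x
    - D * \int[mu]_(x in `[0, 1]) m x| <= e.
Proof.
move=> fK gK mK fgm; have iL k h : unit_lipschitz k h -> mu.-integrable `[0, 1] (EFin \o h).
  by move=> hk; exact: unit_lipschitz_integrable hk _ _.
have fgK := unit_lipschitzB fK gK; have DK := unit_lipschitzZ D mK.
have := normr_Rintegral_itv_le (unit_lipschitzB fgK DK) (lexx 0) ler01 (lexx 1) fgm.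
rewrite RintegralB//; last 2 first.
- exact: iL fgK.
- exact: iL DK.
rewrite RintegralB//; last 2 first.
- exact: iL fK.
- exact: iL gK.
by rewrite RintegralZl// ?subr0 ?mulr1//; exact: iL mK.
Qed.

Variables (Fbar : R -> R) (L : R).
Hypotheses (L_ge0 : 0 <= L) (Fbar_lip : unit_lipschitz L Fbar).


Let cell_bounds N i : (0 < N)%N -> (0 < i <= N)%N ->
  [/\ 0 <= (i%:R - 1) / N%:R :> R, (i%:R - 1) / N%:R <= i%:R / N%:R :> R, i%:R / N%:R <= 1 :> R
    & i%:R / N%:R - (i%:R - 1) / N%:R = N%:R^-1 :> R].
Proof.
move=> N0 /andP[i0 iN]; have N0' : (0:R) < N%:R by rewrite ltr0n.
have i1 : 1 <= i%:R :> R by rewrite ler1n.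
split.
- by rewrite divr_ge0// subr_ge0.
- by rewrite ler_pM2r ?invr_gt0//; lra.
- by rewrite ler_pdivrMr// mul1r ler_nat.
- by field; rewrite gt_eqF.
Qed.

Lemma omega_close N i x : (0 < N)%N -> (0 < i <= N)%N ->
  (i%:R - 1) / N%:R <= x <= i%:R / N%:R -> `|Fbar (1 - x) - omega Fbar N i| <= L / N%:R.
Proof.
move=> N0 iN xi; have [p0 pq q1 qp] := cell_bounds N0 iN.
have N0' : (0:R) < N%:R by rewrite ltr0n.
have G := unit_lipschitz_onem Fbar_lip.
have -> : Fbar (1 - x) - omega Fbar N i = - (N%:R *
    \int[mu]_(y in `[(i%:R - 1) / N%:R, i%:R / N%:R]) (Fbar (1 - y) - Fbar (1 - x))).
  rewrite (Rintegral_sub_cst _ G)// qp /omega.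
  by field; rewrite gt_eqF.
have Gs : unit_lipschitz L (fun y => Fbar (1 - y) - Fbar (1 - x)).
  by move=> u v u01 v01; rewrite opprD opprK addrACA addNr addr0; exact: G.
rewrite normrN normrM (gtr0_norm N0') mulrC -ler_pdivlMr//.
have := normr_Rintegral_itv_le Gs p0 pq q1 (e := L / N%:R); rewrite qp; apply.
move=> y yi; apply: le_trans (G y x _ _) _.
- by case/andP: yi => yp yq; rewrite (le_trans p0)// (le_trans yq).
- by case/andP: xi => xp xq; rewrite (le_trans p0)// (le_trans xq).
rewrite ler_wpM2l// -qp ler_norml; lra.
Qed.

(** As [omega] is the exact cell average, [l i * (Fbar - omega)] integrates to 0 over the cell and
    may be subtracted freely. With [l = 0] this is the Lipschitz estimate; with tangent slopes it
    gains the order [1 / N] that the normalising product requires. *)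
Lemma riemann_sum (psi : R -> R) (K e : R) (l : nat -> R) N : (0 < N)%N ->
  unit_lipschitz K (psi \o Fbar) ->
  (forall i x, (0 < i <= N)%N -> 0 <= x <= 1 -> `|Fbar x - omega Fbar N i| <= L / N%:R ->
    `|psi (Fbar x) - psi (omega Fbar N i) - l i * (Fbar x - omega Fbar N i)| <= e) ->
  `|N%:R * \int[mu]_(x in `[0, 1]) psi (Fbar x) - \sum_(1 <= i < N.+1) psi (omega Fbar N i)|
    <= N%:R * e.
Proof.
move=> N0 psiK psil; have N0' : (0:R) < N%:R by rewrite ltr0n.
have H := unit_lipschitz_onem psiK; have G := unit_lipschitz_onem Fbar_lip.
have -> : \int[mu]_(x in `[0, 1]) psi (Fbar x) = \int[mu]_(x in `[0, 1]) psi (Fbar (1 - x)).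
  by rewrite (Rintegral_onem psiK).
rewrite (Rintegral_unit_split H N0) mulr_sumr -sumrB.
apply: le_trans (ler_norm_sum _ _ _) _.
have -> : N%:R * e = \sum_(1 <= i < N.+1) e.
  by rewrite big_const_nat subn1/= iter_addr addr0 mulr_natl.
rewrite big_nat [leRHS]big_nat; apply: ler_sum => i iN.
have [p0 pq q1 qp] := cell_bounds N0 iN.
pose g x := psi (Fbar (1 - x)) - (psi (omega Fbar N i) - l i * omega Fbar N i) - l i * Fbar (1 - x).
have gE x : g x = psi (Fbar (1 - x)) - psi (omega Fbar N i)
    - l i * (Fbar (1 - x) - omega Fbar N i) by rewrite /g; ring.
have gK : unit_lipschitz (K + `|l i| * L) g.
  move=> u v u01 v01; have -> : g u - g v = (psi (Fbar (1 - u)) - psi (Fbar (1 - v)))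
      - l i * (Fbar (1 - u) - Fbar (1 - v)) by rewrite /g; ring.
  rewrite (le_trans (ler_normB _ _))// mulrDl lerD//; first exact: H.
  by rewrite normrM -mulrA ler_wpM2l// G.
have glip : unit_lipschitz (`|l i| * L) (fun x => l i * Fbar (1 - x)).
  by move=> u v u01 v01; rewrite -mulrBr normrM -mulrA ler_wpM2l// G.
have -> : N%:R * \int[mu]_(x in `[(i%:R - 1) / N%:R, i%:R / N%:R]) psi (Fbar (1 - x))
    - psi (omega Fbar N i) = N%:R * \int[mu]_(x in `[(i%:R - 1) / N%:R, i%:R / N%:R]) g x.
  rewrite RintegralB//; last 2 first.
  - have Hk k : unit_lipschitz K (fun x => psi (Fbar (1 - x)) - k).
      by move=> u v u01 v01; rewrite opprD opprK addrACA addNr addr0; exact: H.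
    exact: unit_lipschitz_integrable (Hk _) _ _.
  - exact: unit_lipschitz_integrable glip _ _.
  rewrite (Rintegral_sub_cst _ H)// qp RintegralZl//; last exact: unit_lipschitz_integrable G _ _.
  have -> : \int[mu]_(x in `[(i%:R - 1) / N%:R, i%:R / N%:R]) Fbar (1 - x) = omega Fbar N i / N%:R.
    by rewrite /omega [RHS]mulrC mulKf// gt_eqF.
  by field; rewrite gt_eqF.
rewrite normrM (gtr0_norm N0') mulrC -ler_pdivlMr//.
have := normr_Rintegral_itv_le gK p0 pq q1 (e := e); rewrite qp; apply => x xi.
have x01 : 0 <= 1 - x <= 1 by case/andP: xi => xp xq; lra.
by rewrite gE; apply: psil => //; exact: omega_close.
Qed.

End riemann_sum.

(** * Cumulants and stationarity *)

Section cumulants.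
Context d (T : measurableType d) (R : realType) (P : probability T R).
Variables (X : {RV P >-> R}).
Hypothesis X_ge0 : forall w, 0 <= X w.
Variables (b b1 lo : R).
Hypotheses (b_gt0 : 0 < b) (bb1 : b < b1) (mgf_fin : ('M_P X b1 < +oo)%E).
Hypothesis (lob : lo <= b).

Let m0_gt0 := mom_gt0 X_ge0 b_gt0 bb1 mgf_fin.
Let m_ge0 := mom_ge0 X_ge0.

Definition cumulant t : R := ln (mom X 0 t).
Definition mom_ratio j t : R := mom X j t / mom X 0 t.
Definition mom_bound j : R := mom X j b / mom X 0 lo.

Lemma log_mgf_cumulant t : t <= b -> log_mgf P X t = (cumulant t)%:E.
Proof.
move=> tb; rewrite /log_mgf (_ : 'M_P X t = (mom X 0 t)%:E)%E ?lne_EFin ?m0_gt0//.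
rewrite /mom /Rintegral fineK; last first.
  exact: (integrable_fin_num measurableT (integrable_xmom X_ge0 bb1 mgf_fin 0 tb)).
rewrite /mmt_gen_fun unlock; apply: eq_integral => w _.
by rewrite /xmom /= mul1r mulrC.
Qed.

Lemma is_derive_mom j t : t < b -> is_derive t 1 (mom X j) (mom X j.+1 t).
Proof.
move=> tb; apply: (@is_derive_quadratic_approx _ _ _ _ (mom X j.+2 b)).
near=> u; have ub : u <= b by apply: ltW; near: u; exact: lt_nbhsl.
by rewrite [leRHS]mulrC; apply: (mom_taylor X_ge0 bb1 mgf_fin) => //; exact: ltW.
Unshelve. all: by end_near.
Qed.

Lemma is_derive_cumulant t : t < b -> is_derive t 1 cumulant (tmean X t).
Proof.
move=> tb; have d0 := is_derive_mom 0 tb.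
have dl := is_derive1_ln (m0_gt0 (ltW tb)).
have := @is_derive1_comp _ (@ln R) (mom X 0) t _ _ dl d0.
by rewrite mulrC.
Qed.

Lemma is_derive_mom_ratio j t : t < b ->
  is_derive t 1 (mom_ratio j) (mom_ratio j.+1 t - mom_ratio j t * mom_ratio 1 t).
Proof.
move=> tb; have d0 := is_derive_mom 0 tb; have dj := is_derive_mom j tb.
have m0n : mom X 0 t != 0 by rewrite gt_eqF// m0_gt0// ltW.
have di := @is_deriveV _ (mom X 0) t _ 1 m0n d0.
rewrite /mom_ratio; apply: is_derive_eq; rewrite /GRing.scale/=.
by field.
Qed.

Lemma is_derive_tmean t : t < b -> is_derive t 1 (tmean X) (tvar X t).
Proof. by move=> tb; have := is_derive_mom_ratio 1 tb; rewrite -expr2. Qed.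

Lemma mom_ratio_ge0 j t : 0 <= mom_ratio j t. Proof. by rewrite divr_ge0. Qed.

Lemma mom_bound_ge0 j : 0 <= mom_bound j. Proof. by rewrite divr_ge0. Qed.

Lemma mom_ratio_le j t : lo <= t <= b -> mom_ratio j t <= mom_bound j.
Proof.
move=> /andP[lt tb]; apply: ler_pM => //; first by rewrite invr_ge0.
  exact: (mom_le X_ge0 bb1 mgf_fin).
by rewrite lef_pV2 ?posrE ?m0_gt0// (mom_le X_ge0 bb1 mgf_fin).
Qed.

(** [fine \o log_mgf] is known to agree with [cumulant] only up to [b], which suffices because
    derivatives are local. *)
Lemma derive1n2_log_mgf t : t < b -> derive1n 2 (fine \o log_mgf P X) t = tvar X t.
Proof.
move=> tb.
have d1 u : u < b -> (fine \o log_mgf P X)^`()%classic u = tmean X u.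
  move=> ub; rewrite derive1E; have := is_derive_cumulant ub => dc.
  rewrite -(@derive_val _ _ _ _ _ _ _ dc); apply: near_eq_derive.
  near=> v => /=; rewrite log_mgf_cumulant//; apply: ltW; near: v; exact: lt_nbhsl.
rewrite /derive1n/= derive1E; have := is_derive_tmean tb => dc.
rewrite -(@derive_val _ _ _ _ _ _ _ dc); apply: near_eq_derive.
by near=> v => /=; apply: d1; near: v; exact: lt_nbhsl.
Unshelve. all: by end_near.
Qed.

Let between (t t' u : R) : lo <= t < b -> lo <= t' < b ->
  Num.min t t' <= u <= Num.max t t' -> lo <= u < b.
Proof. by rewrite ge_min le_max; lra. Qed.

Lemma tmean_lip t t' : lo <= t < b -> lo <= t' < b ->
  `|tmean X t' - tmean X t| <= tbound2 X b lo * `|t' - t|.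
Proof.
move=> tb tb'; apply: (@mvt_abs _ _ (tvar X)) => u /(between tb tb') /andP[lu ub].
  exact: is_derive_tmean.
rewrite ger0_norm; last exact: (tvar_ge0 X_ge0 b_gt0 bb1 mgf_fin (ltW ub)).
by apply: (tvar_le X_ge0 b_gt0 bb1 mgf_fin) => //; rewrite lu ltW.
Qed.

Lemma cumulant_taylor t t' : lo <= t < b -> lo <= t' < b ->
  `|cumulant t' - cumulant t - (t' - t) * tmean X t| <= tbound2 X b lo * (t' - t) ^+ 2.
Proof.
move=> tb tb'; pose g u := cumulant u - u * tmean X t.
have -> : cumulant t' - cumulant t - (t' - t) * tmean X t = g t' - g t by rewrite /g; ring.
rewrite -[(t' - t) ^+ 2]real_normK ?num_real// expr2 mulrA.
apply: (@mvt_abs _ g (fun u => tmean X u - tmean X t)) => u ut.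
  have /andP[lu ub] := between tb tb' ut; have dc := is_derive_cumulant ub.
  by rewrite /g; apply: is_derive_eq; rewrite /GRing.scale/=; ring.
apply: le_trans (tmean_lip tb (between tb tb' ut)) _.
rewrite ler_wpM2l; [by []|by rewrite /tbound2 divr_ge0|].
move: ut; rewrite ge_min le_max.
by have [tt|tt] := leP t t'; [rewrite (ger0_norm (_ : 0 <= t' - t)) |
  rewrite (ler0_norm (_ : t' - t <= 0))]; rewrite ?ler_norml; lra.
Qed.

(** The derivative of [tvar] is [r3 - r2 r1 - 2 r1 (r2 - r1^2)] in the tilted moments [rj]; each is
    replaced by its uniform bound and each minus sign by a plus. *)
Definition tvar_slope : R :=
  mom_bound 3 + mom_bound 2 * mom_bound 1 + 2 * mom_bound 1 * (mom_bound 2 + mom_bound 1 ^+ 2).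

Lemma tvar_slope_ge0 : 0 <= tvar_slope.
Proof.
have B := mom_bound_ge0; have S : 0 <= mom_bound 2 + mom_bound 1 ^+ 2.
  by rewrite addr_ge0 ?sqr_ge0.
have := mulr_ge0 (mulr_ge0 (ler0n R 2) (B 1%N)) S.
have := mulr_ge0 (B 2%N) (B 1%N); have := B 3%N.
by rewrite /tvar_slope; lra.
Qed.

Lemma tvar_lip t t' : lo <= t < b -> lo <= t' < b ->
  `|tvar X t' - tvar X t| <= tvar_slope * `|t' - t|.
Proof.
move=> tb tb'.
pose D u := (mom_ratio 3 u - mom_ratio 2 u * mom_ratio 1 u)
  - 2 * mom_ratio 1 u * (mom_ratio 2 u - mom_ratio 1 u ^+ 2).
apply: (@mvt_abs _ (fun u => mom_ratio 2 u - mom_ratio 1 u ^+ 2) D) => u /(between tb tb') /andP[lu ub].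
  have d2 := is_derive_mom_ratio 2 ub; have d1 := is_derive_mom_ratio 1 ub.
  by apply: is_derive_eq; rewrite /GRing.scale/= /D; ring.
have lub : lo <= u <= b by rewrite lu ltW.
have := mom_ratio_le 1 lub; have := mom_ratio_le 2 lub; have := mom_ratio_le 3 lub.
rewrite /D /tvar_slope.
move: (mom_ratio_ge0 1 u) (mom_ratio_ge0 2 u) (mom_ratio_ge0 3 u).
move: (mom_ratio 1 u) (mom_ratio 2 u) (mom_ratio 3 u) => r1 r2 r3 r10 r20 r30 h3 h2 h1.
have p21 : r2 * r1 <= mom_bound 2 * mom_bound 1 by apply: ler_pM.
have p11 : r1 ^+ 2 <= mom_bound 1 ^+ 2 by rewrite ler_pXn2r ?nnegrE ?mom_bound_ge0.
have p12 : r1 * r2 <= mom_bound 1 * mom_bound 2 by apply: ler_pM.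
have p111 : r1 * r1 ^+ 2 <= mom_bound 1 * mom_bound 1 ^+ 2 by apply: ler_pM; rewrite ?sqr_ge0.
have q1 : 0 <= r2 * r1 by rewrite mulr_ge0.
have q2 : 0 <= r1 * r2 by rewrite mulr_ge0.
have q3 : 0 <= r1 * r1 ^+ 2 by rewrite mulr_ge0 ?sqr_ge0.
by rewrite ler_norml; lra.
Qed.

End cumulants.

(** * Tilted quantities along the profile of [Fbar] *)

Section profile.
Context d (T : measurableType d) (R : realType) (P : probability T R).
Variables (X : {RV P >-> R}).
Hypothesis X_ge0 : forall w, 0 <= X w.
Variables (b b1 lo : R).
Hypotheses (b_gt0 : 0 < b) (bb1 : b < b1) (mgf_fin : ('M_P X b1 < +oo)%E).
Hypothesis (lob : lo <= b).
Variables (Fbar : R -> R) (L M tau : R).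
Hypotheses (L_ge0 : 0 <= L) (Fbar_lip : unit_lipschitz L Fbar).
Hypotheses (M_le1 : M <= 1) (Fbar_bounds : forall x, 0 <= x <= 1 -> 0 <= Fbar x <= M).
Hypothesis tau_bounds : forall y, 0 <= y <= M -> lo <= tau * y < b.
Local Notation mu := (@lebesgue_measure R).

Implicit Types y : R.

Lemma omega_bounds N i : (0 < N)%N -> (0 < i <= N)%N -> 0 <= omega Fbar N i <= M.
Proof.
move=> N0 /andP[i0 iN]; have N0' : (0:R) < N%:R by rewrite ltr0n.
have i1 : 1 <= i%:R :> R by rewrite ler1n.
have p0 : 0 <= (i%:R - 1) / N%:R :> R by rewrite divr_ge0// subr_ge0.
have pq : (i%:R - 1) / N%:R <= i%:R / N%:R :> R by rewrite ler_pM2r ?invr_gt0//; lra.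
have q1 : i%:R / N%:R <= 1 :> R by rewrite ler_pdivrMr// mul1r ler_nat.
have xb x : x \in `[(i%:R - 1) / N%:R, i%:R / N%:R] -> 0 <= Fbar (1 - x) <= M.
  by rewrite in_itv/= => /andP[px xq]; apply: Fbar_bounds; lra.
apply/andP; split.
  by rewrite mulr_ge0//; apply: Rintegral_ge0 => x /xb/andP[].
have -> : M = N%:R * \int[mu]_(x in `[(i%:R - 1) / N%:R, i%:R / N%:R]) M.
  by rewrite Rintegral_cst_itv//; field; rewrite gt_eqF.
rewrite ler_wpM2l//; apply: le_Rintegral => //.
- exact: unit_lipschitz_integrable (unit_lipschitz_onem Fbar_lip) _ _.
- by apply: integrable_itv_continuous; exact: cst_continuous.
- by move=> x /xb/andP[].
Qed.

Lemma unit_lipschitz_comp (psi : R -> R) K : 0 <= K ->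
  (forall y y', 0 <= y <= M -> 0 <= y' <= M -> `|psi y - psi y'| <= K * `|y - y'|) ->
  unit_lipschitz (K * L) (psi \o Fbar).
Proof.
move=> K0 psiK x y x01 y01 /=; rewrite -mulrA.
apply: le_trans (psiK _ _ (Fbar_bounds x01) (Fbar_bounds y01)) _.
by rewrite ler_wpM2l// Fbar_lip.
Qed.

Lemma riemann_lip (psi : R -> R) K N : (0 < N)%N -> 0 <= K ->
  (forall y y', 0 <= y <= M -> 0 <= y' <= M -> `|psi y - psi y'| <= K * `|y - y'|) ->
  `|N%:R * \int[mu]_(x in `[0, 1]) psi (Fbar x) - \sum_(1 <= i < N.+1) psi (omega Fbar N i)|
    <= K * L.
Proof.
move=> N0 K0 psiK; have N0' : (0:R) < N%:R by rewrite ltr0n.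
have -> : K * L = N%:R * (K * (L / N%:R)) by field; rewrite gt_eqF.
apply: (riemann_sum L_ge0 Fbar_lip (l := fun=> 0) N0 (unit_lipschitz_comp K0 psiK)).
move=> i x iN x01 Fx; rewrite mul0r subr0.
apply: le_trans (psiK _ _ (Fbar_bounds x01) (omega_bounds N0 iN)) _.
by rewrite ler_wpM2l.
Qed.

Let tb := tau_bounds.

Let unit_bounds y : 0 <= y <= M -> 0 <= y <= 1.
Proof. by move=> /andP[-> /le_trans->]. Qed.

Let B1 := mom_bound X b lo 1.
Let B10 : 0 <= B1 := mom_bound_ge0 X_ge0 b lo 1.
Let t20 : 0 <= tbound2 X b lo := mom_bound_ge0 X_ge0 b lo 2.

Lemma tmean_le y : 0 <= y <= M -> 0 <= tmean X (tau * y) <= B1.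
Proof.
move=> /tb/andP[ly yb]; rewrite (tmean_ge0 X_ge0)/=.
by apply: (mom_ratio_le X_ge0 b_gt0 bb1 mgf_fin) => //; rewrite ly ltW.
Qed.

(** A Lipschitz constant for [y * tmean (tau * y)] by the product rule, with [y <= 1]; [var_slope]
    is its analogue for [y^2 * tvar (tau * y)]. *)
Definition mean_slope : R := B1 + `|tau| * tbound2 X b lo.

Lemma mean_slope_ge0 : 0 <= mean_slope.
Proof. by rewrite addr_ge0// mulr_ge0. Qed.

Lemma mean_lip y y' : 0 <= y <= M -> 0 <= y' <= M ->
  `|y * tmean X (tau * y) - y' * tmean X (tau * y')| <= mean_slope * `|y - y'|.
Proof.
move=> yM yM'; have /andP[m0 mB] := tmean_le yM.
have := tmean_lip X_ge0 b_gt0 bb1 mgf_fin lob (tb yM') (tb yM).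
rewrite (_ : tau * y - tau * y' = tau * (y - y')); last by rewrite mulrBr.
rewrite [`|tau * (y - y')|]normrM => h.
have -> : y * tmean X (tau * y) - y' * tmean X (tau * y') =
  (y - y') * tmean X (tau * y) + y' * (tmean X (tau * y) - tmean X (tau * y')) by ring.
rewrite (le_trans (ler_normD _ _))// /mean_slope [leRHS]mulrDl lerD//.
  rewrite [leLHS]normrM [leLHS]mulrC; apply: ler_wpM2r => //.
  by rewrite (ger0_norm m0).
have y1 : `|y'| <= 1 by case/andP: (unit_bounds yM') => y0 y1; rewrite ger0_norm.
rewrite normrM; apply: le_trans (ler_wpM2r (normr_ge0 _) y1) _.
by rewrite mul1r (le_trans h)// mulrA [X in X * _]mulrC.
Qed.

Definition var_slope : R := 2 * tbound2 X b lo + `|tau| * tvar_slope X b lo.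

Lemma var_slope_ge0 : 0 <= var_slope.
Proof. by rewrite addr_ge0// mulr_ge0// (tvar_slope_ge0 X_ge0). Qed.

Lemma var_lip y y' : 0 <= y <= M -> 0 <= y' <= M ->
  `|y ^+ 2 * tvar X (tau * y) - y' ^+ 2 * tvar X (tau * y')| <= var_slope * `|y - y'|.
Proof.
move=> yM yM'; have /andP[ly yb] := tb yM.
have v0 := tvar_ge0 X_ge0 b_gt0 bb1 mgf_fin (ltW yb).
have vB : tvar X (tau * y) <= tbound2 X b lo.
  by apply: (tvar_le X_ge0 b_gt0 bb1 mgf_fin) => //; rewrite ly ltW.
have := tvar_lip X_ge0 b_gt0 bb1 mgf_fin lob (tb yM') (tb yM).
rewrite (_ : tau * y - tau * y' = tau * (y - y')); last by rewrite mulrBr.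
rewrite [`|tau * (y - y')|]normrM => h.
have -> : y ^+ 2 * tvar X (tau * y) - y' ^+ 2 * tvar X (tau * y') =
  (y + y') * tvar X (tau * y) * (y - y') + y' ^+ 2 * (tvar X (tau * y) - tvar X (tau * y')).
  by ring.
rewrite (le_trans (ler_normD _ _))// /var_slope [leRHS]mulrDl lerD//.
  rewrite normrM ler_wpM2r// ger0_norm; last by rewrite mulr_ge0//; lra.
  by have := unit_bounds yM; have := unit_bounds yM'; move=> ? ?; apply: ler_pM => //; lra.
have y1 : `|y' ^+ 2| <= 1.
  by case/andP: (unit_bounds yM') => y0 y1; rewrite normrX exprn_ile1// ger0_norm.
rewrite normrM; apply: le_trans (ler_wpM2r (normr_ge0 _) y1) _.
by rewrite mul1r (le_trans h)// mulrA [X in X * _]mulrC.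
Qed.

Lemma cumulant_lip y y' : 0 <= y <= M -> 0 <= y' <= M ->
  `|cumulant X (tau * y) - cumulant X (tau * y')| <=
    (`|tau| * (B1 + tbound2 X b lo * `|tau|)) * `|y - y'|.
Proof.
move=> yM yM'; have /andP[m0 mB] := tmean_le yM'.
have := cumulant_taylor X_ge0 b_gt0 bb1 mgf_fin lob (tb yM') (tb yM).
rewrite -mulrBr -[(tau * (y - y')) ^+ 2]real_normK ?num_real//.
set D := cumulant X (tau * y) - cumulant X (tau * y') => h.
rewrite -(subrK (tau * (y - y') * tmean X (tau * y')) D) (le_trans (ler_normD _ _))//.
apply: le_trans (lerD h (lexx _)) _; rewrite [`|_ * tmean _ _|]normrM (ger0_norm m0) [`|tau * _|]normrM.
have yy : `|y - y'| <= 1.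
  by have := unit_bounds yM; have := unit_bounds yM'; rewrite ler_norml; lra.
have n0 := normr_ge0 (y - y'); have nt := normr_ge0 tau.
move: (`|y - y'|) (`|tau|) n0 nt yy => u v u0 v0 u1.
have e1 : tbound2 X b lo * (v * u) ^+ 2 <= tbound2 X b lo * (v ^+ 2 * u).
  by rewrite ler_wpM2l// exprMn ler_wpM2l ?sqr_ge0// expr2 ler_piMr.
have e2 : v * u * tmean X (tau * y') <= v * u * B1 by rewrite ler_wpM2l// mulr_ge0.
by apply: le_trans (lerD e1 e2) _; rewrite le_eqVlt; apply/orP; left; apply/eqP; ring.
Qed.

Lemma unit_lipschitz_cumulant :
  exists K, unit_lipschitz K (fun x => cumulant X (tau * Fbar x)).
Proof.
exists (`|tau| * (B1 + tbound2 X b lo * `|tau|) * L).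
by apply: (@unit_lipschitz_comp (fun y => cumulant X (tau * y)));
  [rewrite mulr_ge0// addr_ge0// mulr_ge0 | exact: cumulant_lip].
Qed.

(** Tangents taken at the cell averages make the error quadratic in [L / N] on each cell. A total of
    order [1 / N] rather than [O(1)] is essential, since the sum is exponentiated. *)
Lemma riemann_cumulant N : (0 < N)%N ->
  `|N%:R * \int[mu]_(x in `[0, 1]) cumulant X (tau * Fbar x)
    - \sum_(1 <= i < N.+1) cumulant X (tau * omega Fbar N i)|
    <= tbound2 X b lo * tau ^+ 2 * L ^+ 2 / N%:R.
Proof.
move=> N0; have N0' : (0:R) < N%:R by rewrite ltr0n.
have -> : tbound2 X b lo * tau ^+ 2 * L ^+ 2 / N%:R =
  N%:R * (tbound2 X b lo * tau ^+ 2 * (L / N%:R) ^+ 2) by field; rewrite gt_eqF.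
have [K Klip] := unit_lipschitz_cumulant.
apply: (riemann_sum L_ge0 Fbar_lip (psi := fun y => cumulant X (tau * y))
  (l := fun i => tau * tmean X (tau * omega Fbar N i)) N0 Klip).
move=> i x iN x01 Fx.
have := cumulant_taylor X_ge0 b_gt0 bb1 mgf_fin lob
  (tb (omega_bounds N0 iN)) (tb (Fbar_bounds x01)).
rewrite -mulrBr mulrAC exprMn => /le_trans; apply.
rewrite mulrA ler_wpM2l ?(mulr_ge0 t20) ?sqr_ge0// -real_normK ?num_real// ler_pXn2r ?nnegrE//.
by rewrite divr_ge0// ltW.
Qed.

End profile.

(** * The first-order condition at the maximiser *)

Section stationary.
Context d (T : measurableType d) (R : realType) (P : probability T R).
Variables (X : {RV P >-> R}).
Hypothesis X_ge0 : forall w, 0 <= X w.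
Variables (b b1 lo : R).
Hypotheses (b_gt0 : 0 < b) (bb1 : b < b1) (mgf_fin : ('M_P X b1 < +oo)%E).
Hypothesis (lob : lo <= b).
Variables (Fbar : R -> R) (L M : R).
Hypotheses (L_ge0 : 0 <= L) (Fbar_lip : unit_lipschitz L Fbar).
Hypotheses (M_le1 : M <= 1) (Fbar_bounds : forall x, 0 <= x <= 1 -> 0 <= Fbar x <= M).
Variables (a theta : R).
Local Notation mu := (@lebesgue_measure R).
Local Notation tilt s := (expR s - 1).
Hypothesis tau_bounds : \forall s \near theta, forall y, 0 <= y <= M -> lo <= tilt s * y < b.

Lemma stationary :
  (\forall s \near theta,
    s * a - \int[mu]_(x in `[0, 1]) cumulant X (tilt s * Fbar x) <=
    theta * a - \int[mu]_(x in `[0, 1]) cumulant X (tilt theta * Fbar x)) ->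
  a = expR theta * \int[mu]_(x in `[0, 1]) (Fbar x * tmean X (tilt theta * Fbar x)).
Proof.
move=> hmax; set A := \int[mu]_(x in _) (Fbar x * _).
pose K := tbound2 X b lo.
have K0 : 0 <= K by exact: (mom_bound_ge0 X_ge0 b lo 2).
have tb0 := nbhs_singleton tau_bounds.
(* The objective is only known to second order, so its Taylor minorant [phi],
   which touches it at [theta], is differentiated instead. *)
pose phi s := s * a - (expR s - expR theta) * A - K * (expR s - expR theta) ^+ 2.
have dphi (s : R) : is_derive s 1 phi (a - expR s * A - 2 * K * expR s * (expR s - expR theta)).
  by rewrite /phi; apply: is_derive_eq; rewrite /GRing.scale/=; ring.
have aux (sa ta I1 I0 D e : R) : `|I1 - I0 - D * A| <= e -> sa - I1 <= ta - I0 ->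
    sa - D * A - e <= ta by rewrite ler_norml => /andP[_ +]; lra.
have phimax : \forall s \near theta, phi s <= phi theta.
  near=> s.
  have tbs : forall y, 0 <= y <= M -> lo <= tilt s * y < b by near: s.
  have [k0 lip0] := unit_lipschitz_cumulant X_ge0 b_gt0 bb1 mgf_fin lob Fbar_lip M_le1 Fbar_bounds tb0.
  have [k1 lip1] := unit_lipschitz_cumulant X_ge0 b_gt0 bb1 mgf_fin lob Fbar_lip M_le1 Fbar_bounds tbs.
  have hs : s * a - \int[mu]_(x in `[0, 1]) cumulant X (tilt s * Fbar x) <=
    theta * a - \int[mu]_(x in `[0, 1]) cumulant X (tilt theta * Fbar x) by near: s.
  have lipm : unit_lipschitz _ (fun x => Fbar x * tmean X (tilt theta * Fbar x)) :=
    unit_lipschitz_comp Fbar_lip Fbar_bounds (psi := fun y => y * tmean X (tilt theta * y))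
      (mean_slope_ge0 X_ge0 b lo _)
      (mean_lip X_ge0 b_gt0 bb1 mgf_fin lob M_le1 tb0).
  have h := Rintegral_approx lip1 lip0 lipm (D := expR s - expR theta)
    (e := K * (expR s - expR theta) ^+ 2) _.
  have -> : phi theta = theta * a by rewrite /phi subrr expr0n/= mul0r mulr0 !subr0.
  apply: (aux _ _ _ _ _ _ (h _) hs) => x x01; have FM := Fbar_bounds x01.
  have := cumulant_taylor X_ge0 b_gt0 bb1 mgf_fin lob (tb0 _ FM) (tbs _ FM).
  have -> : tilt s * Fbar x - tilt theta * Fbar x = (expR s - expR theta) * Fbar x by ring.
  rewrite -mulrA => /le_trans; apply; rewrite ler_wpM2l// exprMn ler_piMr ?sqr_ge0//.
  by case/andP: FM => F0 FM; rewrite exprn_ile1//; exact: le_trans FM M_le1.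
have [r /= r0 rP] := phimax.
have tr : theta \in `]theta - r, theta + r[ by rewrite in_itv/=; lra.
have dmax : is_derive theta 1 phi 0.
  apply: (@derive1_at_max _ _ (theta - r) (theta + r)) => //; first by lra.
  move=> t; rewrite in_itv/= => tin; apply: rP => /=; rewrite ltr_norml; lra.
have := @derive_val _ _ _ _ _ _ _ (dphi theta).
rewrite (@derive_val _ _ _ _ _ _ _ dmax) subrr mulr0 subr0 => /eqP.
by rewrite eq_sym subr_eq0 => /eqP.
Unshelve. all: by end_near.
Qed.

End stationary.

(** * Asymptotics *)

Section local_limit_theorem.
Context d (T : measurableType d) (R : realType) (P : probability T R).
Variables (X : nat -> {RV P >-> R}).
Hypotheses (X_iid : iid X) (X_ge0 : forall i w, 0 <= X i w).
Variables (b b1 lo : R).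
Hypotheses (b_gt0 : 0 < b) (bb1 : b < b1) (mgf_fin : ('M_P (X 0%N) b1 < +oo)%E).
Hypothesis (lob : lo <= b).
Variables (Fbar : R -> R) (L M : R).
Hypotheses (L_ge0 : 0 <= L) (Fbar_lip : unit_lipschitz L Fbar).
Hypotheses (M_le1 : M <= 1) (Fbar_bounds : forall x, 0 <= x <= 1 -> 0 <= Fbar x <= M).
Variables (a z tau : R).
Hypotheses (a_gt0 : 0 < a) (z_gt0 : 0 < z) (tauE : tau = z - 1).
Hypothesis tau_bounds : forall y, 0 <= y <= M -> lo <= tau * y < b.
Local Notation mu := (@lebesgue_measure R).
Hypothesis a_stationary :
  a = z * \int[mu]_(x in `[0, 1]) (Fbar x * tmean (X 0%N) (tau * Fbar x)).
Implicit Types (N i k : nat).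

(** Extended by 0 outside [1..N], so that the tilts [tau * rate N i] lie in [[lo, b]] for every [i],
    as the replacement lemmas ask. *)
Definition rate N i : R := if (0 < i <= N)%N then omega Fbar N i else 0.
(** The gap between the tilted mean of [z S] and [N a], on the scale [sqrt N]. *)
Definition dev_shift N : R :=
  (z * \sum_(1 <= i < N.+1) rate N i * tmean (X 0%N) (tau * rate N i) - N%:R * a) / Num.sqrt N%:R.
Definition limit_var : R :=
  z ^+ 2 * \int[mu]_(x in `[0, 1]) (Fbar x ^+ 2 * tvar (X 0%N) (tau * Fbar x)).
Local Notation var_at N := (tilt_var X (rate N) tau (z / Num.sqrt N%:R) N).

Let M_ge0 : 0 <= M.
Proof. by have /andP[/le_trans h /h] := @Fbar_bounds 0 (introT andP (conj (lexx 0) ler01)). Qed.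

Lemma rate_bounds N i : 0 <= rate N i <= M.
Proof.
rewrite /rate; case: ifP => [iN|_]; last by rewrite lexx.
by apply: (omega_bounds Fbar_lip Fbar_bounds) => //; case/andP: iN => /leq_trans /[apply].
Qed.

Let tau_rate N i : lo <= tau * rate N i <= b.
Proof. by have /tau_bounds/andP[-> /ltW] := rate_bounds N i. Qed.

Let sum_rate N (f : R -> R) :
  \sum_(1 <= i < N.+1) f (rate N i) = \sum_(1 <= i < N.+1) f (omega Fbar N i).
Proof. by rewrite big_nat [RHS]big_nat; apply: eq_bigr => i iN; rewrite /rate iN. Qed.

Let m0_gt0 N i : 0 < mom (X 0%N) 0 (tau * rate N i).
Proof. by apply: (mom_gt0 (X_ge0 0) b_gt0 bb1 mgf_fin); case/andP: (tau_rate N i). Qed.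

Lemma cvg_tilt_norm :
  tilt_norm X (rate N) tau N /
    expR (N%:R * \int[mu]_(x in `[0, 1]) cumulant (X 0%N) (tau * Fbar x)) @[N --> \oo] --> (1 : R).
Proof.
set I := \int[mu]_(x in _) _.
pose S N := \sum_(1 <= i < N.+1) cumulant (X 0%N) (tau * rate N i).
have E N : tilt_norm X (rate N) tau N / expR (N%:R * I) = expR (S N - N%:R * I).
  rewrite expRD expRN; congr (_ / _); rewrite expR_sum; apply: eq_bigr => i _.
  by rewrite lnK// posrE m0_gt0.
have h : expR (S N - N%:R * I) @[N --> \oo] --> expR (0 : R).
  apply: (@continuous_cvg _ _ _ _ _ (fun N => S N - N%:R * I) expR); first exact: continuous_expR.
  apply: cvg_norm_le (cvg_harmonicM (tbound2 (X 0%N) b lo * tau ^+ 2 * L ^+ 2)).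
  near=> N; rewrite subr0 distrC /S (sum_rate N (fun y => cumulant (X 0%N) (tau * y))).
  have N0 : (0 < N)%N by near: N; exact: nbhs_infty_gt.
  exact: (riemann_cumulant (X_ge0 0) b_gt0 bb1 mgf_fin lob L_ge0 Fbar_lip M_le1 Fbar_bounds tau_bounds N0).
rewrite expR0 in h; apply: cvg_trans h; apply: near_eq_cvg; near=> N.
by rewrite E.
Unshelve. all: by end_near.
Qed.

Lemma cvg_invsqrt : (Num.sqrt N%:R)^-1 @[N --> \oo] --> (0 : R).
Proof.
have h : Num.sqrt (1 / N%:R) @[N --> \oo] --> Num.sqrt (0 : R).
  exact: (cvg_comp _ _ (cvg_harmonicM 1) (@sqrt_continuous R 0)).
rewrite sqrtr0 in h; apply: cvg_trans h; apply: near_eq_cvg; near=> N.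
by rewrite div1r sqrtrV.
Unshelve. all: by end_near.
Qed.

Let cvg_scale (c : R) : c / Num.sqrt N%:R @[N --> \oo] --> (0 : R).
Proof. by rewrite -(mulr0 c); apply: cvgM; [exact: cvg_cst | exact: cvg_invsqrt]. Qed.

(** Stationarity makes the numerator a Riemann-sum error, which is [O(1)]. *)
Lemma cvg_dev_shift : dev_shift N @[N --> \oo] --> (0 : R).
Proof.
pose A := \int[mu]_(x in `[0, 1]) (Fbar x * tmean (X 0%N) (tau * Fbar x)).
apply: cvg_norm_le (cvg_scale (z * (mean_slope (X 0%N) b lo tau * L))); near=> N.
have N0 : (0 < N)%N by near: N; exact: nbhs_infty_gt.
have N0' : (0:R) < N%:R by rewrite ltr0n.
have s0 : (0:R) < Num.sqrt N%:R by rewrite sqrtr_gt0.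
have := riemann_lip L_ge0 Fbar_lip Fbar_bounds N0 (mean_slope_ge0 (X_ge0 0) b lo tau)
  (mean_lip (X_ge0 0) b_gt0 bb1 mgf_fin lob M_le1 tau_bounds).
rewrite -(sum_rate N (fun y => y * tmean (X 0%N) (tau * y))) subr0 /dev_shift a_stationary -/A.
move: (\sum_(1 <= i < N.+1) _) => s h.
rewrite (_ : z * s - N%:R * (z * A) = - (z * (N%:R * A - s))); last by ring.
have i0 : 0 < (Num.sqrt N%:R)^-1 :> R by rewrite invr_gt0.
rewrite normrM normrN normrM (gtr0_norm z_gt0) (gtr0_norm i0).
by apply: ler_wpM2r; [exact: ltW | apply: ler_wpM2l => //; exact: ltW].
Unshelve. all: by end_near.
Qed.

Lemma cvg_var_at : var_at N @[N --> \oo] --> limit_var.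
Proof.
apply: cvg_norm_le (cvg_harmonicM (z ^+ 2 * (var_slope (X 0%N) b lo tau * L))); near=> N.
have N0 : (0 < N)%N by near: N; exact: nbhs_infty_gt.
have N0' : (0:R) < N%:R by rewrite ltr0n.
have := riemann_lip L_ge0 Fbar_lip Fbar_bounds N0 (var_slope_ge0 (X_ge0 0) b lo tau)
  (var_lip (X_ge0 0) b_gt0 bb1 mgf_fin lob M_le1 tau_bounds).
rewrite -(sum_rate N (fun y => y ^+ 2 * tvar (X 0%N) (tau * y))) /limit_var.
have -> : var_at N = z ^+ 2 / N%:R * \sum_(1 <= i < N.+1) rate N i ^+ 2 * tvar (X 0%N) (tau * rate N i).
  rewrite mulr_sumr; apply: eq_bigr => i _.
  by rewrite mulrA !exprMn exprVn sqr_sqrtr ?(ltW N0').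
move: (\sum_(1 <= i < N.+1) _) (\int[mu]_(x in _) _) => s A h.
rewrite (_ : _ - _ = - (z ^+ 2 / N%:R * (N%:R * A - s))); last first.
  by field; rewrite gt_eqF.
have c0 : 0 <= z ^+ 2 / N%:R by rewrite divr_ge0 ?sqr_ge0.
by rewrite normrN normrM (ger0_norm c0) [leRHS]mulrAC ler_wpM2l.
Unshelve. all: by end_near.
Qed.

Lemma limit_var_ge0 : 0 <= limit_var.
Proof.
rewrite mulr_ge0 ?sqr_ge0//; apply: Rintegral_ge0 => x /=; rewrite in_itv/= => /Fbar_bounds Fx.
rewrite mulr_ge0 ?sqr_ge0//; apply: (tvar_ge0 (X_ge0 0) b_gt0 bb1 mgf_fin).
by have /andP[_ /ltW] := tau_bounds Fx.
Qed.

(** There are [N] terms of orders [N^(-3/2)] and [N^(-2)], as every step has size at most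
    [z / sqrt N]. *)
Lemma lindeberg_err_le C N : 0 <= C -> (0 < N)%N ->
  lindeberg_err X (rate N) b lo (z / Num.sqrt N%:R) C N <=
  C * (tbound3 (X 0%N) b lo * z ^+ 3 * (Num.sqrt N%:R)^-1
       + tbound2 (X 0%N) b lo ^+ 2 * z ^+ 4 * (Num.sqrt N%:R)^-1 ^+ 2).
Proof.
move=> C0 N0; have N0' : (0:R) < N%:R by rewrite ltr0n.
have s0 : (0:R) < Num.sqrt N%:R by rewrite sqrtr_gt0.
have sN : Num.sqrt N%:R ^+ 2 = N%:R :> R by rewrite sqr_sqrtr// ltW.
have t30 : 0 <= tbound3 (X 0%N) b lo.
  have B j := mom_bound_ge0 (X_ge0 0) b lo j.
  by rewrite mulr_ge0// addr_ge0 ?exprn_ge0 ?B//; exact: B 3%N.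
move: t30; rewrite /lindeberg_err; move: (tbound3 _ _ _) (tbound2 _ _ _) => t3 t2 t30.
set g := z / Num.sqrt N%:R; have g0 : 0 <= g by rewrite divr_ge0// ltW.
apply: (@le_trans _ _ (\sum_(1 <= i < N.+1) C * (t3 * g ^+ 3 + t2 ^+ 2 * g ^+ 4))).
  apply: ler_sum => i _; have /andP[r0 rM] := rate_bounds N i.
  have gr : 0 <= g * rate N i <= g.
    by rewrite mulr_ge0//= ler_piMr// (le_trans rM).
  have /andP[gr0 grg] := gr.
  rewrite (ger0_norm gr0) ler_wpM2l//; apply: lerD; apply: ler_wpM2l; rewrite ?sqr_ge0//.
    by rewrite ler_pXn2r.
  by rewrite ler_pXn2r.
rewrite big_const_nat subn1/= iter_addr addr0 -[_ *+ N]mulr_natl.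
rewrite le_eqVlt; apply/orP; left; apply/eqP; rewrite /g.
by move: sN s0; move: (Num.sqrt N%:R) => s <- s0; field; rewrite gt_eqF.
Qed.

Local Notation lattice := [set N : nat | exists k : nat, N%:R * a = k%:R :> R].

Lemma cvg_lattice (f : nat -> R) (l : R) :
  f N @[N --> \oo] --> l -> f N @[N --> within lattice \oo] --> l.
Proof. by move=> h; apply: cvg_trans h; apply: cvg_app; exact: cvg_within. Qed.

(* [Num.truncn (N%:R * a)] is the integer [N a] itself along [lattice]. *)
Definition point_mass N : R :=
  fine (tilted X (rate N) tau (z / Num.sqrt N%:R) (dev_shift N) N
    (fun u => poisson_ratio (Num.truncn (N%:R * a))
       (Num.max 0 ((Num.truncn (N%:R * a))%:R + Num.sqrt N%:R * u)))).

Lemma cvg_point_mass :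
  point_mass N @[N --> within lattice \oo] --> Num.sqrt a / Num.sqrt (a + limit_var).
Proof.
have [C C0 hC] := heat_step a_gt0.
have v0 := limit_var_ge0.
have av0 : 0 < a + limit_var by rewrite ltr_pwDl.
pose E := expR (ln a / 2).
(* With [eta = N^(-1/4)] the two parts of the Poisson error, [2 eta / a] and
   [2 / (a^2 eta^2 N) = 2 / (a^2 sqrt N)], both vanish. *)
pose h N : R := (Num.sqrt N%:R)^-1; pose eta N := Num.sqrt (h N).
have ch : h N @[N --> \oo] --> (0 : R) by exact: cvg_invsqrt.
have ceta : eta N @[N --> \oo] --> (0 : R).
  rewrite -[X in _ --> X](sqrtr0 R).
  exact: (cvg_comp _ _ ch (@sqrt_continuous R 0)).
pose e N : R := (2 / a * eta N + 2 / a ^+ 2 * h N) * (var_at N + dev_shift N ^+ 2)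
  + E * C * (tbound3 (X 0%N) b lo * z ^+ 3 * h N + tbound2 (X 0%N) b lo ^+ 2 * z ^+ 4 * h N ^+ 2).
have ce : e N @[N --> \oo] --> (0 : R).
  have -> : 0 = (2 / a * 0 + 2 / a ^+ 2 * 0) * (limit_var + 0 ^+ 2)
    + E * C * (tbound3 (X 0%N) b lo * z ^+ 3 * 0 + tbound2 (X 0%N) b lo ^+ 2 * z ^+ 4 * 0 ^+ 2) :> R.
    by rewrite expr0n/= !mulr0 !addr0 mul0r mulr0 addr0.
  have c2 (f : nat -> R) (l : R) : f N @[N --> \oo] --> l -> f N ^+ 2 @[N --> \oo] --> l ^+ 2.
    by move=> fl; apply: (cvgM fl fl).
  have cc (k l : R) (f : nat -> R) : f N @[N --> \oo] --> l -> k * f N @[N --> \oo] --> k * l.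
    by move=> fl; apply: cvgM => //; exact: cvg_cst.
  apply: cvgD; last by apply: (cc); apply: cvgD; apply: (cc) => //; exact: c2.
  apply: cvgM; first by apply: cvgD; apply: (cc).
  by apply: cvgD; [exact: cvg_var_at | apply: c2; exact: cvg_dev_shift].
have cheat : E * heat (a + var_at N) (dev_shift N) @[N --> \oo] -->
    Num.sqrt a / Num.sqrt (a + limit_var).
  have -> : Num.sqrt a / Num.sqrt (a + limit_var) =
      E * expR (- (ln (a + limit_var) / 2) - 0 * 0 / (2 * (a + limit_var))).
    rewrite !mul0r subr0 -ln_sqrtE// expRN lnK ?posrE ?sqrtr_gt0//.
    by rewrite /E -ln_sqrtE// lnK// posrE sqrtr_gt0.
  have cav : a + var_at N @[N --> \oo] --> a + limit_var.
    by apply: cvgD; [exact: cvg_cst | exact: cvg_var_at].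
  apply: cvgM; first exact: cvg_cst.
  apply: (@continuous_cvg _ _ _ _ _ (fun N => - (ln (a + var_at N) / 2)
    - dev_shift N ^+ 2 / (2 * (a + var_at N))) expR); first exact: continuous_expR.
  apply: cvgB.
    apply: cvgN; apply: cvgM; last exact: cvg_cst.
    by apply: continuous_cvg cav; exact: continuous_ln.
  apply: cvgM; first by apply: cvgM; exact: cvg_dev_shift.
  apply: cvgV; first by rewrite mulf_neq0// gt_eqF.
  by apply: cvgM cav; exact: cvg_cst.
have hm : point_mass N - E * heat (a + var_at N) (dev_shift N) @[N --> within lattice \oo] --> (0 : R).
  apply: cvg_norm_le (cvg_lattice ce).
  have hN : \forall N \near \oo, (0 < N)%N by exact: nbhs_infty_gt.
  have he : \forall N \near \oo, `|eta N| <= 2^-1 by apply: (cvgr_norm_le _ ceta); rewrite normr0 invr_gt0.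
  rewrite near_withinE; near=> N => -[k kE]; rewrite subr0.
  have N0 : (0 < N)%N by near: N.
  have N0' : (0:R) < N%:R by rewrite ltr0n.
  have s0 : (0:R) < Num.sqrt N%:R by rewrite sqrtr_gt0.
  have k0 : (0 < k)%N by rewrite -(ltr0n R) -kE mulr_gt0.
  have eta2 : `|eta N| <= 2^-1 by near: N.
  have eta0 : 0 < eta N by rewrite /eta sqrtr_gt0 invr_gt0.
  have etab : 0 < eta N <= 2^-1 by rewrite eta0/= -(gtr0_norm eta0).
  have [r rE rle] := local_tilted X_iid X_ge0 b_gt0 bb1 mgf_fin lob
    (z / Num.sqrt N%:R) (dev_shift N) (tau_rate N)
    k0 a_gt0 (esym kE) etab C0 hC.
  rewrite /point_mass kE natrK rE /=.
  apply: le_trans rle _; rewrite /e; apply: lerD; last first.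
    by apply: lindeberg_err_le => //; rewrite mulr_ge0// ltW ?expR_gt0.
  rewrite le_eqVlt; apply/orP; left; apply/eqP; congr (_ * _).
  have eta_sqr : eta N ^+ 2 = (Num.sqrt N%:R)^-1.
    by rewrite /eta sqr_sqrtr// /h invr_ge0 ltW.
  have sN : Num.sqrt N%:R ^+ 2 = N%:R :> R by rewrite sqr_sqrtr// ltW.
  rewrite eta_sqr -kE /h; move: sN s0; move: (Num.sqrt N%:R) (eta N) => s t <- s0.
  by field; rewrite !gt_eqF.
rewrite -[X in _ --> X]add0r; apply: cvg_trans (cvgD hm (cvg_lattice cheat)).
by apply: near_eq_cvg; near=> N; rewrite /= subrK.
Unshelve. all: by end_near.
Qed.

End local_limit_theorem.

(** * Assembly of the asymptotic equivalence *)

Section auxiliary.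
Context {R : realType}.

Lemma cvg_truncn_mul (a : R) : 0 < a -> Num.truncn (N%:R * a) @[N --> \oo] --> \oo.
Proof.
move=> a0; apply/cvgnyPge => A; near=> N.
rewrite truncn_ge_nat ?mulr_ge0 ?(ltW a0)// -ler_pdivrMr//.
apply: (@le_trans _ _ (Num.truncn (A%:R / a)).+1%:R); first exact/ltW/truncnS_gt.
by rewrite ler_nat; near: N; exact: nbhs_infty_ge.
Unshelve. all: by end_near.
Qed.

Lemma ccdf_bounds d (T : measurableType d) (P : probability T R) (S : {RV P >-> R})
    (F Fbar : R -> R) : (forall x, (F x)%:E = cdf S x) -> (forall x, Fbar x = 1 - F x) ->
  forall x y, x <= y -> 0 <= Fbar y <= Fbar x.
Proof.
move=> FS FbarE x y xy; rewrite !FbarE subr_ge0 lerD2l lerN2.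
by rewrite -lee_fin FS cdf_le1 /= -lee_fin !FS cdf_nondecreasing.
Qed.

End auxiliary.

(* [X 0] plays the role of the generic variable X, and [S] that of a service
   time with distribution function [F]. *)
Theorem proposition5p1 (R : realType)
    (d : measure_display) (T : measurableType d) (P : probability T R)
    (X : nat -> {RV P >-> R})
    (X_iid : iid X)
    (X_ge0 : forall i w, 0 <= X i w)
    (nu : R) (X_mean : ('E_P[X 0%N] = nu%:E)%E)
    (X_mgf : \forall t \near (0 : R), ('M_P (X 0%N) t < +oo)%E)
    (d' : measure_display) (T' : measurableType d') (P' : probability T' R)
    (S : {RV P' >-> R}) (S_ge0 : forall w, 0 <= S w)
    (F Fbar : R -> R)
    (F_cdf : forall x, (F x)%:E = @cdf d' T' R P' S x)
    (FbarE : forall x, Fbar x = 1 - F x)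
    (a : R)
    (a_gt : nu * \int[lebesgue_measure]_(x in `[0, 1]) Fbar x < a)
    (theta : R)
    (theta_argsup : is_argsup (rate_objective (X 0%N) Fbar a) theta)
    (theta_mgf : forall x, x \in `[0, 1] ->
       \forall t \near Fbar x * (expR theta - 1), ('M_P (X 0%N) t < +oo)%E)
    (Fbar_diff : twice_differentiable_on `[0, 1] Fbar) :
  q_prob X Fbar a N / q_check (X 0%N) Fbar a theta N
    @[N --> within [set N : nat | exists k : nat, N%:R * a = k%:R] \oo]
    --> (1 : R).
Proof.
pose z := expR theta; pose tau := z - 1.
have z_gt0 : 0 < z by exact: expR_gt0.
have Fmono := ccdf_bounds F_cdf FbarE.
pose M := Fbar 0.
have F_bounds x : 0 <= x <= 1 -> 0 <= Fbar x <= M by move=> /andP[x0 _]; exact: Fmono.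
have M_ge0 : 0 <= M by have /andP[] := Fmono 0 0 (lexx _).
have M_le1 : M <= 1.
  by rewrite /M FbarE gerBl -lee_fin F_cdf cdf_ge0.
have [L L_ge0 F_lip] := unit_lipschitz_diff Fbar_diff.
(* [B] is an upper bound for the tilts [tau * y], [0 <= y <= M]. Finiteness around it comes from
   [theta_mgf] at [x = 0] when [tau * M >= 0], and from [X_mgf] otherwise. *)
pose B := Num.max 0 (tau * M).
have [e e_gt0 mgf_B] : exists2 e, 0 < e & forall t, B <= t <= B + e -> ('M_P (X 0%N) t < +oo)%E.
  have : \forall t \near B, ('M_P (X 0%N) t < +oo)%E.
    rewrite /B; case: (leP 0 (tau * M)) => _; last exact: X_mgf.
    by rewrite mulrC; apply: theta_mgf; rewrite in_itv/= lexx ler01.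
  move=> [r /= r0 rP]; exists (r / 2); first by rewrite divr_gt0.
  move=> t Bt; apply: rP => /=; rewrite distrC ger0_norm; lra.
have B_ge0 : 0 <= B by rewrite le_max lexx.
pose b := B + e / 2; pose b1 := B + e.
have b_gt0 : 0 < b by rewrite /b; lra.
have bb1 : b < b1 by rewrite /b /b1; lra.
have mgf_b1 : ('M_P (X 0%N) b1 < +oo)%E by apply: mgf_B; rewrite /b1; lra.
(* The margins, 1 below and [e / 2] above, leave room to perturb theta; they dictate the radius
   [Num.min 1 (e / 2)] in [tau_near]. *)
pose lo := - `|tau| - 1.
have tau0 := normr_ge0 tau.
have lob : lo <= b by rewrite /lo; lra.
have tauM y : 0 <= y <= M -> - `|tau| <= tau * y <= B.
  move=> /andP[y0 yM]; apply/andP; split.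
    rewrite lerNl -mulrN; apply: le_trans (ler_norm _) _.
    by rewrite normrM normrN (ger0_norm y0) ler_piMr// (le_trans yM).
  rewrite /B le_max; have [t0|t0] := leP 0 tau; last by rewrite mulr_le0_ge0// ltW.
  by rewrite ler_wpM2l ?orbT.
have tau_bounds y : 0 <= y <= M -> lo <= tau * y < b.
  by move=> /tauM; rewrite /lo /b; lra.
have tau_near : \forall s \near theta, forall y, 0 <= y <= M -> lo <= (expR s - 1) * y < b.
  pose r := Num.min 1 (e / 2).
  have r0 : 0 < r by rewrite lt_min ltr01 divr_gt0.
  have : \forall s \near theta, `|expR theta - expR s| < r.
    by have /cvgrPdist_lt := @continuous_expR R theta; apply.
  apply: filterS => s; rewrite lt_min => /andP[s1 s2] y yM; have := tauM y yM.
  have -> : (expR s - 1) * y = tau * y - (expR theta - expR s) * y by rewrite /tau /z; ring.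
  have : `|(expR theta - expR s) * y| <= `|expR theta - expR s|.
    by case/andP: yM => y0 yM; rewrite normrM ler_piMr// ger0_norm// (le_trans yM).
  rewrite /lo /b ler_norml; lra.
have nu_ge0 : 0 <= nu by rewrite -lee_fin -X_mean expectation_ge0.
have a_gt0 : 0 < a.
  apply: le_lt_trans a_gt; rewrite mulr_ge0//; apply: Rintegral_ge0 => x /=.
  by rewrite in_itv/= => /F_bounds/andP[].
have in01 (x : R) : `[0%R, 1%R]%classic x -> 0 <= x <= 1 by rewrite /= in_itv.
have cumulantE s x : (forall y, 0 <= y <= M -> lo <= (expR s - 1) * y < b) -> 0 <= x <= 1 ->
    log_mgf P (X 0%N) (Fbar x * (expR s - 1)) = (cumulant (X 0%N) ((expR s - 1) * Fbar x))%:E.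
  move=> sb x01; rewrite mulrC (log_mgf_cumulant (X_ge0 0) b_gt0 bb1 mgf_b1)//.
  by have /andP[_ /ltW] := sb _ (F_bounds x x01).
have objectiveE s : (forall y, 0 <= y <= M -> lo <= (expR s - 1) * y < b) ->
    rate_objective (X 0%N) Fbar a s = (s * a -
      \int[lebesgue_measure]_(x in `[0, 1]) cumulant (X 0%N) ((expR s - 1) * Fbar x))%:E.
  move=> sb; rewrite /rate_objective EFinB; congr (_ - _)%E.
  have [K Klip] := unit_lipschitz_cumulant (X_ge0 0) b_gt0 bb1 mgf_b1 lob F_lip M_le1 F_bounds sb.
  have iK := unit_lipschitz_integrable Klip (lexx 0) (lexx 1).
  rewrite /Rintegral fineK; last by apply: integrable_fin_num iK.
  by apply: eq_integral => x; rewrite inE => /in01 x01; rewrite cumulantE.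
have a_stationary : a = z * \int[lebesgue_measure]_(x in `[0, 1])
    (Fbar x * tmean (X 0%N) (tau * Fbar x)).
  apply: (stationary (X_ge0 0) b_gt0 bb1 mgf_b1 lob F_lip M_le1 F_bounds tau_near).
  apply: filterS tau_near => s sb.
  have le_fine (u v : \bar R) x y : u = x%:E -> v = y%:E -> (u <= v)%E -> x <= y.
    by move=> -> ->; rewrite lee_fin.
  apply: (le_fine _ _ _ _ (objectiveE s sb) (objectiveE theta tau_bounds)).
  by rewrite [leRHS]theta_argsup; apply: ereal_sup_ubound; exists s.
have sigma2E : sigma2 (X 0%N) Fbar a theta = a + limit_var X Fbar z tau.
  rewrite /sigma2 /limit_var; congr (_ + _).
  have [K Klip] : exists K, unit_lipschitz K (fun x => Fbar x ^+ 2 * tvar (X 0%N) (tau * Fbar x)).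
    exists (var_slope (X 0%N) b lo tau * L).
    exact: (unit_lipschitz_comp F_lip F_bounds (psi := fun y => y ^+ 2 * tvar (X 0%N) (tau * y))
      (var_slope_ge0 (X_ge0 0) b lo tau)
      (var_lip (X_ge0 0) b_gt0 bb1 mgf_b1 lob M_le1 tau_bounds)).
  rewrite -RintegralZl//; last exact: unit_lipschitz_integrable Klip _ _.
  apply: eq_Rintegral => x; rewrite inE => /in01 /F_bounds Fx.
  have /andP[_ xb] := tau_bounds _ Fx.
  rewrite mulrC in xb; rewrite (derive1n2_log_mgf (X_ge0 0) b_gt0 bb1 mgf_b1 xb) -/z -/tau.
  rewrite [tau * _]mulrC (_ : expR (2 * theta) = z ^+ 2); last by rewrite -expRM_natl.
  by move: (tvar _ _) => t; ring.
pose I := \int[lebesgue_measure]_(x in `[0, 1]) cumulant (X 0%N) (tau * Fbar x).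
have IE : \int[lebesgue_measure]_(x in `[0, 1]) fine (log_mgf P (X 0%N) (Fbar x * (expR theta - 1))) = I.
  by apply: eq_Rintegral => x; rewrite inE => /in01 x01; rewrite cumulantE.
have v0 := limit_var_ge0 (X := X) X_ge0 b_gt0 bb1 mgf_b1 F_bounds z tau_bounds.
have s0 : 0 < Num.sqrt (a + limit_var X Fbar z tau) by rewrite sqrtr_gt0 ltr_pwDl.
have sa0 : 0 < Num.sqrt a by rewrite sqrtr_gt0.
have tauE : tau = z - 1 by [].
have T1 := cvg_lattice a (cvg_tilt_norm X_ge0 b_gt0 bb1 mgf_b1 lob L_ge0 F_lip M_le1 F_bounds tau_bounds).
have T2 := cvg_lattice a (cvg_comp _ _ (cvg_truncn_mul a_gt0) (@cvg_stirling R)).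
have T3 := cvg_point_mass X_iid X_ge0 b_gt0 bb1 mgf_b1 lob L_ge0 F_lip M_le1 F_bounds
  a_gt0 z_gt0 tau_bounds a_stationary.
have T4 : Num.sqrt (a + limit_var X Fbar z tau) / Num.sqrt a
    @[N --> within [set N : nat | exists k : nat, N%:R * a = k%:R] \oo] -->
    Num.sqrt (a + limit_var X Fbar z tau) / Num.sqrt a by exact: cvg_cst.
have limE : 1 * 1 * (Num.sqrt a / Num.sqrt (a + limit_var X Fbar z tau) *
    (Num.sqrt (a + limit_var X Fbar z tau) / Num.sqrt a)) = 1 :> R.
  by field; rewrite !gt_eqF.
pose stirling (k : nat) : R := k%:R ^+ k * expR (- k%:R) * Num.sqrt (2 * pi * k%:R) / k`!%:R.
(* For large [N] with [N a] an integer, [q_prob / q_check] equals this product exactly: normalising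
   constant, Stirling factor at [k = N a], and the tilted point mass divided by its limit. *)
pose approx N := tilt_norm X (rate Fbar N) tau N / expR (N%:R * I) *
  stirling (Num.truncn (N%:R * a)) * (point_mass X Fbar a z tau N *
  (Num.sqrt (a + limit_var X Fbar z tau) / Num.sqrt a)).
have lim1 : approx N @[N --> within [set N : nat | exists k : nat, N%:R * a = k%:R] \oo] --> (1 : R).
  by rewrite -[X in _ --> X]limE; exact: (cvgM (cvgM T1 T2) (cvgM T3 T4)).
apply: cvg_trans lim1; apply: near_eq_cvg.
have hN : \forall N \near \oo, (0 < N)%N by exact: nbhs_infty_gt.
rewrite near_withinE; near=> N => -[k kE].
have N0 : (0 < N)%N by near: N.
have N0' : (0:R) < N%:R by rewrite ltr0n.
have k0 : (0 < k)%N by rewrite -(ltr0n R) -kE mulr_gt0.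
have k0' : (0:R) < k%:R by rewrite ltr0n.
have tau_rate i : lo <= tau * rate Fbar N i <= b.
  by have /andP[-> /ltW] := tau_bounds _ (rate_bounds F_lip F_bounds N i).
have [C C0 hC] := heat_step a_gt0.
(* Here [local_tilted] only serves to show that the tilted expectation is a real number [r]; its
   estimate is discarded, so any admissible [eta] does. *)
pose eta : R := 2^-1.
have half : 0 < eta <= 2^-1 by rewrite /eta lexx andbT invr_gt0.
have [r rE _] := local_tilted X_iid X_ge0 b_gt0 bb1 mgf_b1 lob
    (z / Num.sqrt N%:R) (dev_shift X Fbar a z tau N) tau_rate
    k0 a_gt0 (esym kE) half C0 hC.
have qE : q_prob X Fbar a N =
    z ^- k * (k%:R ^+ k * expR (- k%:R) / k`!%:R) * tilt_norm X (rate Fbar N) tau N * r.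
  rewrite /q_prob (_ : (fun w => _) = wsum X (rate Fbar N) N); last first.
    apply/funext => w; rewrite /wsum big_nat [RHS]big_nat; apply: eq_bigr => i iN.
    by rewrite /rate iN.
  rewrite (_ : [set _ | _] = [set k]); last first.
    apply/seteqP; split=> j /=; rewrite kE; last by move=> ->.
    by move=> /eqP; rewrite eqr_nat => /eqP.
  rewrite (mixed_poisson_tilted X_ge0 b_gt0 bb1 mgf_b1 tau_rate k0 N0 z_gt0 _ tauE erefl
    (u0 := dev_shift X Fbar a z tau N)).
  - by rewrite rE.
  - by move=> i; have /andP[] := rate_bounds F_lip F_bounds N i.
  - by rewrite /dev_shift kE.
have pE : point_mass X Fbar a z tau N = r by rewrite /point_mass kE natrK rE.
set v := limit_var X Fbar z tau in s0 *.
rewrite /approx /stirling kE natrK pE.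
rewrite qE /q_check IE sigma2E -/v.
have -> : expR (- (theta * N%:R * a)) = z ^- k.
  by rewrite /z -expRM_natl -expRN -kE; congr expR; ring.
have pi0 : 0 < pi :> R by exact: pi_gt0.
have -> : Num.sqrt (2 * pi * k%:R) = Num.sqrt (2 * pi * N%:R) * Num.sqrt a.
  by rewrite -sqrtrM ?mulr_ge0 ?(ltW pi0)// -kE mulrA.
have p0 : 0 < Num.sqrt (2 * pi * N%:R) :> R by rewrite sqrtr_gt0 !mulr_gt0.
have zk0 : 0 < z ^- k by rewrite invr_gt0 exprn_gt0.
have f0 : 0 < k`!%:R :> R by rewrite ltr0n fact_gt0.
move: (expR_gt0 (N%:R * I)) p0 zk0 f0 s0 sa0.
move: (expR (N%:R * I)) (Num.sqrt (2 * pi * N%:R)) (z ^- k) (k`!%:R : R)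
  (Num.sqrt (a + v)) (Num.sqrt a) (k%:R ^+ k) (expR (- k%:R)) (tilt_norm _ _ _ _)
  => e1 e2 e3 e4 e5 e6 e7 e8 e9 p1 p2 p3 p4 p5 p6.
by field; rewrite !gt_eqF.
Unshelve. all: by end_near.
Qed.
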